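(* Let $N\ge 2$, let $\lambda>0$, and consider the system of $N$ identical hard disks of diameter $d$, $0<d<1/N$, in the channel with twisting walls described in the context. Let $U$ be the set of phase states with $v_i\neq 0$ for all $i$ and $$|x_i-x_j|>d+s_i+s_j\qquad\text{for all } i\neq j,$$ where $|x_i-x_j|$ denotes the distance on the circle $\mathbb{R}/\mathbb{Z}$ and $s_i$ is the total horizontal displacement of the $i$th disk as defined in the context. Then $U$ is an open subset of the phase space of positive Lebesgue measure, and it is forward invariant: every trajectory starting in $U$ stays in $U$ at all future times. Along every trajectory starting in $U$ the disks never collide with each other in the future, the trajectory of the center of each disk converges to a vertical line, and the phase trajectory converges at an exponential rate to the set $\{u_1=\cdots=u_N=0\}$; that is, for every initial state in $U$ there are constants $C,c>0$ such that $|u_i(t)|\le Ce^{-ct}$ for all $t\ge 0$ and all $i$.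
   Context: The model: $N$ identical hard disks (same mass, same diameter $d$) move in the unit square $\{0\le x\le 1,\ 0\le y\le 1\}$ with rigid walls at $y=0$ and $y=1$ and periodic boundary conditions in $x$ (i.e. $x\in\mathbb{R}/\mathbb{Z}$). The $i$th disk has center $(x_i,y_i)$ and velocity $(u_i,v_i)$. The disks move freely between collisions and collide elastically with each other. When a disk collides with a wall (its center is at $y=d/2$ or $y=1-d/2$ and it moves toward that wall) its incoming velocity $(u^-,v^-)$ is replaced by the outgoing velocity $(u^+,v^+)$ which points away from the wall and is determined by conservation of speed, $(u^+)^2+(v^+)^2=(u^-)^2+(v^-)^2$, together with $$\frac{u^+}{|v^+|}=e^{-\lambda}\,\frac{u^-}{|v^-|}.$$ (Equivalently, with angles of incidence $\varphi$ and reflection $\psi$ in $[0,\pi]$ such that $u^-/|v^-|=\cot\varphi$ and $u^+/|v^+|=\cot\psi$, one has $\tan\psi=e^{\lambda}\tan\varphi$; $\lambda=0$ is specular reflection.) The phase space is the energy surface: the total kinetic energy is fixed at a positive value, and it has dimension $4N-1$. As usual, states before and after a wall collision are identified. For a disk with center $(x_i,y_i)$ and velocity $(u_i,v_i)$, $v_i\ne0$, the number $s_i\ge 0$ denotes the total displacement in the $x$ direction (the total horizontal distance travelled by the center over all future time, measured in the universal cover of the circle) that this disk would make if it moved between the walls alone, as if the other disks did not exist. *)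

(* Defs.v *)
From HB Require Import structures.
From mathcomp Require Import all_boot all_order all_algebra.
From mathcomp Require Import all_classical all_reals all_analysis.

Set Implicit Arguments.
Unset Strict Implicit.
Unset Printing Implicit Defensive.

Import Order.TTheory GRing.Theory Num.Theory.
Import numFieldNormedType.Exports.

Local Open Scope classical_set_scope.
Local Open Scope ring_scope.

(* MathComp-Analysis.  A state of n disks is an n x 4 real matrix whose i-th row
   is (x_i, y_i, u_i, v_i).  The coordinate x_i is a real number standing for a
   point of R/Z: states differing by integer shifts of the x_i are the same
   phase point, see [identified] below. *)
Definition state (R : realType) (n : nat) := 'M[R]_(n, 4).

Section Channel.
Variables (R : realType) (n : nat).
Implicit Types (z w : state R n) (i j : 'I_n) (A : set (state R n)).

Definition posx z i : R := z i (inord 0).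
Definition posy z i : R := z i (inord 1).
Definition velx z i : R := z i (inord 2).
Definition vely z i : R := z i (inord 3).

Definition mk_state (x y u v : 'I_n -> R) : state R n :=
  \matrix_(i, k) [:: x i; y i; u i; v i]`_k.

Definition circle_dist (a b : R) : R :=
  inf [set `|a - b + k%:~R| | k in [set: int]].

Definition centre_dist z i j : R :=
  Num.sqrt (circle_dist (posx z i) (posx z j) ^+ 2 +
            (posy z i - posy z j) ^+ 2).

(* d is the diameter of the disks, lam the twisting parameter of the walls,
   m the mass of each disk and E the total kinetic energy. *)
Variables (d lam m E : R).

Definition admissible z : Prop :=
  (forall i, d / 2 <= posy z i <= 1 - d / 2) /\
  (forall i j, i != j -> d <= centre_dist z i j).

Definition kinetic_energy z : R :=
  m / 2 * \sum_(i < n) (velx z i ^+ 2 + vely z i ^+ 2).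

Definition phase_space : set (state R n) :=
  [set z | admissible z /\ kinetic_energy z = E].

Definition wall_hit z i : Prop :=
  (posy z i = d / 2 /\ vely z i < 0) \/ (posy z i = 1 - d / 2 /\ 0 < vely z i).

(* The first clause says that the outgoing velocity points away from the wall
   (the incoming one points towards it); it also makes the denominators of the
   last clause nonzero. *)
Definition wall_law (u v u' v' : R) : Prop :=
  [/\ v * v' < 0,
      u' ^+ 2 + v' ^+ 2 = u ^+ 2 + v ^+ 2 &
      u' / `|v'| = expR (- lam) * (u / `|v|)].

Definition touching z i j : Prop := i != j /\ centre_dist z i j = d.

(* Disks i and j are in contact and approach each other; p is the vector of
   length d from the centre of j to the centre of i. *)
Definition disk_hit z i j (p : R * R) : Prop :=
  [/\ touching z i j,
      exists k : int, p.1 = posx z i - posx z j + k%:~R,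
      p.2 = posy z i - posy z j,
      p.1 ^+ 2 + p.2 ^+ 2 = d ^+ 2 &
      (velx z i - velx z j) * p.1 + (vely z i - vely z j) * p.2 < 0].

Definition normal_speed z i j (p : R * R) : R :=
  ((velx z i - velx z j) * p.1 + (vely z i - vely z j) * p.2) / d ^+ 2.

(* The passage from the state z just before an instant to the state w at (and
   just after) it, as far as disk i is concerned.  An elastic collision of two
   equal masses exchanges the components of their velocities along p.  There is
   no constructor for a disk taking part in two collisions at once: the motion
   is then undefined.  Collisions of distinct disks (or disjoint pairs) at the
   same instant are independent of each other. *)
Variant impact_at z w i : Prop :=
| NoImpact of ~ wall_hit z i & (forall j p, ~ disk_hit z i j p) &
    velx w i = velx z i & vely w i = vely z i
| WallImpact of wall_hit z i & (forall j p, ~ disk_hit z i j p) &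
    wall_law (velx z i) (vely z i) (velx w i) (vely w i)
| DiskImpact j p of ~ wall_hit z i & disk_hit z i j p &
    (forall j' p', disk_hit z i j' p' -> j' = j) &
    velx w i = velx z i - normal_speed z i j p * p.1 &
    vely w i = vely z i - normal_speed z i j p * p.2.

Definition impact z w : Prop :=
  forall i, [/\ posx w i = posx z i, posy w i = posy z i & impact_at z w i].

Definition free_flight (t : R) z : state R n :=
  mk_state (fun i => posx z i + t * velx z i) (fun i => posy z i + t * vely z i)
           (velx z) (vely z).

(* z is a trajectory on the time interval [0, T[ starting at z0.  The x_i(t)
   are lifted continuously to the universal cover of the circle.  At collision
   times z takes the outgoing velocities; accordingly z 0 is z0 itself except
   that velocities incoming in z0 are replaced by the outgoing ones. *)
Definition trajectory (T : \bar R) (z0 : state R n) (z : R -> state R n) :=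
  [/\ impact z0 (z 0),
      forall t : R, 0 <= t -> (t%:E < T)%E -> admissible (z t),
      forall t : R, 0 <= t -> (t%:E < T)%E ->
        \forall s \near t^'+, z s = free_flight (s - t) (z t) &
      forall t : R, 0 < t -> (t%:E < T)%E ->
        exists2 z_ : state R n, impact z_ (z t) &
          \forall s \near t^'-, z s = free_flight (s - t) z_].

(* Phase points are equivalence classes of states for the equivalence relation
   generated by [identified]: integer shifts of the x_i, and identification of
   the states before and after a wall collision.  Sets of phase points are
   thus the saturated sets of states, and the open ones (for the quotient of
   the subspace topology) are the saturated relatively open sets. *)
Definition identified z w : Prop :=
  forall i, [/\ exists k : int, posx w i = posx z i + k%:~R,
    posy w i = posy z i &
    (velx w i = velx z i /\ vely w i = vely z i) \/
    (wall_hit z i /\ wall_law (velx z i) (vely z i) (velx w i) (vely w i))].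

Definition phase_open A : Prop :=
  (forall z w, identified z w -> (A z <-> A w)) /\
  exists2 O : set (state R n), open O & A = phase_space `&` O.

End Channel.

(* Lebesgue measure on R^k, as an iterated product of the measure on R. *)
Fixpoint lebesgue_tuple (R : realType) (k : nat) :
    set (k.-tuple (measurableTypeR R)) -> \bar R :=
  match k with
  | 0 => fun A => \d_[tuple] A
  | k'.+1 => pushforward
      (product_measure1 (@lebesgue_measure R) (@lebesgue_tuple R k'))
      (fun p => [tuple of p.1 :: p.2])
  end.

Definition lebesgue_state (R : realType) (n : nat) (A : set (state R n)) :
    \bar R :=
  lebesgue_tuple [set t : (n * 4).-tuple (measurableTypeR R) |
    A (\matrix_(i, k) (tnth t (mxvec_index i k) : R))].

(* The (4n-1)-dimensional Lebesgue measure of a subset A of the energy surface: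
   Lebesgue measure on the positions times the surface measure on the sphere of
   velocities.  The latter is, up to a constant factor, the volume of the cone
   over the set.  Positions are counted once, with x_i in [0, 1[. *)
Definition phase_measure (R : realType) (n : nat) (A : set (state R n)) :
    \bar R :=
  lebesgue_state [set w | (forall i, 0 <= posx w i < 1) /\
    exists (r : R) (z : state R n), [/\ 0 < r <= 1, A z &
      w = mk_state (posx z) (posy z) (fun i => r * velx z i)
                   (fun i => r * vely z i)]].

(* s_i: row i z is the state of the system consisting of disk i alone, whose
   trajectory w is unique when v_i <> 0; the distance it travels horizontally
   during [0, T] is the total variation of its (lifted) x coordinate. *)
Definition total_displacement (R : realType) (n : nat) (d lam : R)
    (z : state R n) (i : 'I_n) : \bar R :=
  ereal_sup [set s | exists (w : R -> state R 1) (T : R),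
    [/\ trajectory d lam +oo (row i z : state R 1) w, 0 <= T &
        s = total_variation 0 T (fun t => posx (w t) ord0)]].

Definition non_colliding (R : realType) (n : nat) (d lam m E : R) :
    set (state R n) :=
  [set z | [/\ phase_space d m E z, forall i, vely z i != 0 &
    forall i j, i != j ->
      ((circle_dist (posx z i) (posx z j))%:E >
       d%:E + total_displacement d lam z i + total_displacement d lam z j)%E]].

(* Main.v *)
(* For a disk alone in the channel the slope [|u| / |v|] is multiplied by
   [exp (- lam)] at each wall collision, so its total horizontal displacement is
   a geometric series with an explicit sum, here called its reach.  In free
   flight the reach decreases at exactly the rate [|u|], and it does not change
   at a wall: along the motion the horizontal displacement equals the drop of
   the reach.  The condition that the horizontal gap of every pair exceeds [d]
   plus both reaches is therefore preserved, and it excludes contact.  Since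
   [|v|] never decreases, [|u|] is at least a constant times the reach, which
   hence decays exponentially; it dominates [|u|] in turn. *)
Require Import Defs.
From HB Require Import structures.
From mathcomp Require Import all_boot all_order all_algebra.
From mathcomp Require Import all_classical all_reals all_analysis.
From mathcomp Require Import ring lra zify.

Set Implicit Arguments.
Unset Strict Implicit.
Unset Printing Implicit Defensive.

Import Order.TTheory GRing.Theory Num.Theory.
Import numFieldNormedType.Exports.

Local Open Scope classical_set_scope.
Local Open Scope ring_scope.

(** A trajectory is given by germs only: free flight just after each instant, and an impact ending a
    free flight just before it. It comes with no list of collision times, so invariants are carried
    along by induction over the real line. Separation has to be part of that induction, because it
    is what excludes disk impacts at the next instant. [total_displacement] is a supremum over the
    trajectories of a single disk. Identifying it with the reach takes a formula valid for every
    such trajectory and also the existence of one, since otherwise the supremum would run over the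
    empty set. That trajectory is built bounce by bounce, and the bounce times must be shown to be
    unbounded. One-disk trajectories are then glued into a trajectory of all disks. For the measure,
    the reach depends on a velocity only through its slope and vertical direction, so the cone over
    the set is cut out by the same inequalities and contains an explicit cube. *)

(** * Induction over a real interval *)

Lemma real_induction (R : realType) (P : R -> Prop) (a b : R) :
  a <= b -> P a ->
  (forall t, a <= t < b -> P t -> \forall s \near t^'+, P s) ->
  (forall t, a < t <= b -> (forall s, a <= s < t -> P s) -> P t) ->
  P b.
Proof.
move=> ab Pa Pright Pleft.
(* Membership asks for [P] on all of [[a, t]], so that [Pleft] applies at the supremum of [A]. *)
pose A := [set t | a <= t <= b /\ forall s, a <= s <= t -> P s].
have Aa : A a.
  split=> [|s /le_anti <-//]; by rewrite lexx ab.
have ubA : ubound A b by move=> t [/andP[]].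
have supA : has_sup A by split; [exists a | exists b].
pose c := sup A.
have ac : a <= c by apply: ub_le_sup => //; exists b.
have cb : c <= b by apply: ge_sup => //; exists a.
have Pc' s : a <= s < c -> P s.
  case/andP=> as_ sc.
  have [|t [_ At] ct] := @sup_adherent _ A (c - s) _ supA; first by rewrite subr_gt0.
  by apply: At; rewrite as_/= ltW//; move: ct; rewrite subKr.
have Pc : P c.
  have [-> //|ac'] := eqVneq c a.
  by apply: Pleft => //; rewrite lt_neqAle eq_sym ac' ac.
have [<-//|cNb] := eqVneq c b.
have cltb : c < b by rewrite lt_neqAle cNb.
have := Pright c; rewrite ac cltb => /(_ isT Pc) /nbhs_ballP[e /= e0 Pe].
pose t := Num.min b (c + e / 2).
have ct : c < t by rewrite lt_min cltb ltrDl divr_gt0.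
suff : A t by move/(ub_le_sup (ex_intro _ b ubA)); rewrite leNgt ct.
split; first by rewrite (le_trans ac (ltW ct)) ge_min lexx.
move=> s /andP[as_ st]; have [sc|cs|->//] := ltgtP s c.
  by apply: Pc'; rewrite as_.
apply: Pe => //; rewrite /ball/= ltr_norml.
move: st; rewrite le_min => /andP[_ st]; apply/andP; split; lra.
Qed.

(** * One disk: the reach in flight and at a wall *)

Section OneDisk.
Variables (R : realType) (d lam : R).
Hypotheses (lam_gt0 : 0 < lam) (d_lt1 : d < 1).
Implicit Types (x y u v : R).

(* The vertical distance from height [y] to the wall that a disk with vertical
   velocity [v] is moving towards. *)
Definition ahead d y v := (2^-1 - y) * (v / `|v|) + (1 - d) / 2.

(* Each wall collision multiplies [|u| / |v|] by [expR (- lam)], so [tail] is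
   the geometric series of the crossings after the next collision. *)
Definition tail d lam : R := (1 - d) / (expR lam - 1).

Definition reach d lam y u v := `|u| / `|v| * (ahead d y v + tail d lam).

Lemma expR_lam_gt1 : 1 < expR lam.
Proof. by rewrite expR_gt1. Qed.

Lemma tail_gt0 : 0 < tail d lam.
Proof. by rewrite divr_gt0// subr_gt0// expR_lam_gt1. Qed.

(** A geometric series of ratio [expR (- lam)] reproduces itself when its first term is split
    off. *)
Lemma tailE : expR (- lam) * (1 - d + tail d lam) = tail d lam.
Proof.
have h : expR lam - 1 != 0 by rewrite gt_eqF// subr_gt0 expR_lam_gt1.
by rewrite expRN /tail; field; rewrite h gt_eqF ?expR_gt0.
Qed.

Lemma ahead_pos y v : 0 < v -> ahead d y v = 1 - d / 2 - y.
Proof. by move=> v0; rewrite /ahead gtr0_norm// divff ?gt_eqF//; field. Qed.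

Lemma ahead_neg y v : v < 0 -> ahead d y v = y - d / 2.
Proof.
by move=> v0; rewrite /ahead ltr0_norm// invrN mulrN divff ?lt_eqF//; field.
Qed.

Lemma ahead_bounds y v : v != 0 -> d / 2 <= y <= 1 - d / 2 ->
  0 <= ahead d y v <= 1 - d.
Proof.
rewrite neq_lt => /orP[] v0 /andP[y1 y2].
  by rewrite ahead_neg//; apply/andP; split; lra.
by rewrite ahead_pos//; apply/andP; split; lra.
Qed.

Lemma ahead_flight y v (s : R) : v != 0 ->
  ahead d (y + s * v) v = ahead d y v - s * `|v|.
Proof.
rewrite neq_lt => /orP[] v0.
  by rewrite !ahead_neg// ltr0_norm//; ring.
by rewrite !ahead_pos// gtr0_norm//; ring.
Qed.

Lemma reach_flight y u v (s : R) : v != 0 ->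
  reach d lam (y + s * v) u v = reach d lam y u v - s * `|u|.
Proof.
by move=> v0; rewrite /reach ahead_flight//; field; rewrite normr_eq0.
Qed.

Lemma reach_ge0 y u v : v != 0 -> d / 2 <= y <= 1 - d / 2 ->
  0 <= reach d lam y u v.
Proof.
move=> v0 /(ahead_bounds v0) /andP[h _].
by rewrite mulr_ge0 ?divr_ge0// addr_ge0// ltW// tail_gt0.
Qed.

(** At most one full crossing lies ahead. This turns the loss rate [|u|] of the reach into a rate
    proportional to the reach itself. *)
Lemma reach_rate y u v : v != 0 -> d / 2 <= y <= 1 - d / 2 ->
  reach d lam y u v * `|v| <= `|u| * (1 - d + tail d lam).
Proof.
move=> v0 /(ahead_bounds v0) /andP[_ h].
have -> : reach d lam y u v * `|v| = `|u| * (ahead d y v + tail d lam).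
  by rewrite /reach; field; rewrite normr_eq0.
by rewrite ler_wpM2l// lerD2r.
Qed.

(** The converse bound, obtained by dropping the current crossing; it carries the decay of the reach
    over to the velocity. *)
Lemma velx_le_reach y u v : v != 0 -> d / 2 <= y <= 1 - d / 2 ->
  `|u| * tail d lam <= reach d lam y u v * `|v|.
Proof.
move=> v0 /(ahead_bounds v0) /andP[h _].
have -> : reach d lam y u v * `|v| = `|u| * (ahead d y v + tail d lam).
  by rewrite /reach; field; rewrite normr_eq0.
by rewrite ler_wpM2l// lerDr.
Qed.

Section Wall.
Variables (y u v u' v' : R).
Hypothesis wall : (y = d / 2 /\ v < 0) \/ (y = 1 - d / 2 /\ 0 < v).
Hypothesis law : wall_law lam u v u' v'.

Lemma wall_vely_neq0 : v != 0 /\ v' != 0.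
Proof.
by case: law => /ltr0_neq0 h _ _; move: h; rewrite mulf_eq0 negb_or => /andP.
Qed.

Lemma wall_abs_velx : `|u'| / `|v'| = expR (- lam) * (`|u| / `|v|).
Proof.
case: law => _ _ /(congr1 Num.norm).
by rewrite !normrM !normrV ?unitfE ?normr_eq0 ?(proj1 wall_vely_neq0)
  ?(proj2 wall_vely_neq0)// !normr_id (ger0_norm (expR_ge0 _)).
Qed.

Lemma wall_sgr_velx : Num.sg u' = Num.sg u.
Proof.
case: law => _ _ /(congr1 Num.sg); have [v0 v'0] := wall_vely_neq0.
by rewrite !sgrM !(gtr0_sg (x := _^-1)) ?invr_gt0 ?normr_gt0//
  (gtr0_sg (expR_gt0 _)) mul1r !mulr1.
Qed.

(** A smaller slope at the same speed means a velocity closer to the vertical. *)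
Lemma wall_vely_le : `|v| <= `|v'|.
Proof.
have [v0 v'0] := wall_vely_neq0; have [_ e _] := law.
have h : `|u'| * `|v| <= `|u| * `|v'|.
  have -> : `|u'| * `|v| = expR (- lam) * (`|u| * `|v'|).
    have -> : `|u'| * `|v| = `|u'| / `|v'| * (`|v| * `|v'|).
      by field; rewrite normr_eq0.
    by rewrite wall_abs_velx; field; rewrite normr_eq0.
  by rewrite ler_piMl ?mulr_ge0// -expR0 ler_expR oppr_le0 ltW.
(* If [|v|] dropped, the bound on slopes would keep [|u|] from growing, and speed would be lost. *)
rewrite leNgt; apply/negP => vv'.
have u'u : `|u'| <= `|u|.
  rewrite leNgt; apply/negP => uu'.
  have : `|u| * `|v'| < `|u'| * `|v|.
    by rewrite ltr_pM.
  by rewrite ltNge h.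
have : `|u'| ^+ 2 + `|v'| ^+ 2 < `|u| ^+ 2 + `|v| ^+ 2.
  by rewrite ler_ltD// ?lerXn2r ?ltrXn2r ?nnegrE.
by rewrite !real_normK ?num_real// e ltxx.
Qed.

(** At a wall [ahead] jumps from 0 to the full crossing [1 - d] while the slope is multiplied by
    [expR (- lam)]; by [tailE] the two changes cancel. *)
Lemma reach_wall : reach d lam y u' v' = reach d lam y u v.
Proof.
have [_ v'0] := wall_vely_neq0; have [vv' _ _] := law.
rewrite /reach wall_abs_velx.
have [ah ah'] : ahead d y v = 0 /\ ahead d y v' = 1 - d.
  case: wall => [[-> v0]|[-> v0]].
    by move: vv'; rewrite nmulr_rlt0// => ?; rewrite ahead_neg// ahead_pos//; split; lra.
  by move: vv'; rewrite pmulr_rlt0// => ?; rewrite ahead_pos// ahead_neg//; split; lra.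
by rewrite ah ah' add0r -{2}tailE; ring.
Qed.

End Wall.

End OneDisk.

(** * The distance on the circle *)

Section CircleDist.
Variable R : realType.
Implicit Types a b c : R.

Lemma circle_dist_le a b (k : int) : circle_dist a b <= `|a - b + k%:~R|.
Proof. by apply: ge_inf; [exists 0 => _ [l _ <-] | exists k]. Qed.

Lemma circle_dist_ge a b c :
  (forall k : int, c <= `|a - b + k%:~R|) -> c <= circle_dist a b.
Proof.
by move=> h; apply: lb_le_inf => [|_ [k _ <-]//]; exists `|a - b + 0%:~R|, 0.
Qed.

Lemma circle_dist_ge0 a b : 0 <= circle_dist a b.
Proof. exact: circle_dist_ge. Qed.

(** Lets displacements measured in lifted coordinates be charged against gaps on the circle. *)
Lemma circle_dist_lipschitz a b a' b' :
  circle_dist a b <= circle_dist a' b' + `|a - a'| + `|b - b'|.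
Proof.
rewrite -!lerBlDr; apply: circle_dist_ge => k; rewrite !lerBlDr.
apply: le_trans (circle_dist_le a b k) _.
have -> : a - b + k%:~R = a' - b' + k%:~R + (a - a') - (b - b') by ring.
by rewrite (le_trans (ler_normB _ _))// lerD2r ler_normD.
Qed.

Lemma circle_dist_shift a b (k l : int) :
  circle_dist (a + k%:~R) (b + l%:~R) = circle_dist a b.
Proof.
apply/le_anti/andP; split; apply: circle_dist_ge => h.
  apply: le_trans (circle_dist_le _ _ (h - k + l)) _.
  by rewrite rmorphD rmorphB/=; rewrite le_eqVlt; apply/predU1P; left; congr `| _ |; ring.
apply: le_trans (circle_dist_le _ _ (h + k - l)) _.
by rewrite rmorphB rmorphD/=; rewrite le_eqVlt; apply/predU1P; left; congr `| _ |; ring.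
Qed.

End CircleDist.

Section States.
Variables (R : realType) (n : nat).
Implicit Types (z w : state R n) (i : 'I_n) (x y u v : 'I_n -> R).

Lemma mk_stateE x y u v i :
  [/\ posx (mk_state x y u v) i = x i, posy (mk_state x y u v) i = y i,
      velx (mk_state x y u v) i = u i & vely (mk_state x y u v) i = v i].
Proof. by split; rewrite /posx /posy /velx /vely mxE inordK. Qed.

Lemma posx_mk x y u v i : posx (mk_state x y u v) i = x i.
Proof. by case: (mk_stateE x y u v i). Qed.
Lemma posy_mk x y u v i : posy (mk_state x y u v) i = y i.
Proof. by case: (mk_stateE x y u v i). Qed.
Lemma velx_mk x y u v i : velx (mk_state x y u v) i = u i.
Proof. by case: (mk_stateE x y u v i). Qed.
Lemma vely_mk x y u v i : vely (mk_state x y u v) i = v i.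
Proof. by case: (mk_stateE x y u v i). Qed.

Definition coord_mk := (posx_mk, posy_mk, velx_mk, vely_mk).

Lemma state_ext z w :
  (forall i, [/\ posx z i = posx w i, posy z i = posy w i,
                 velx z i = velx w i & vely z i = vely w i]) -> z = w.
Proof.
move=> h; apply/matrixP => i k; case: (h i) => h0 h1 h2 h3.
rewrite -[k]inord_val; case: k => [[|[|[|[|//]]]] ?] //=.
Qed.

Lemma free_flightD (s t : R) z :
  free_flight s (free_flight t z) = free_flight (t + s) z.
Proof.
by apply: state_ext => i; rewrite /free_flight !coord_mk; split => //; ring.
Qed.

Lemma free_flight0 z : free_flight 0 z = z.
Proof.
by apply: state_ext => i; rewrite /free_flight !coord_mk; split => //; ring.
Qed.

End States.

(** * Separated states and their evolution along a trajectory *)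

Section Channel.
Variables (R : realType) (n : nat) (d lam : R).
Hypotheses (lam_gt0 : 0 < lam) (d_lt1 : d < 1).
Implicit Types (z w : state R n) (i j : 'I_n).

Definition disk_reach d lam z i :=
  reach d lam (posy z i) (velx z i) (vely z i).

Definition reach_separated d lam z := forall i j, i != j ->
  d + disk_reach d lam z i + disk_reach d lam z j <
  circle_dist (posx z i) (posx z j).

Definition in_channel d z := forall i, d / 2 <= posy z i <= 1 - d / 2.

Definition moving z := forall i, vely z i != 0.

(* What survives when a disk evolves from its state in [z] to that in [w]
   without meeting other disks; the displacement is the drop of the reach. *)
Definition advances z w i : Prop :=
  [/\ vely w i != 0,
      velx w i ^+ 2 + vely w i ^+ 2 = velx z i ^+ 2 + vely z i ^+ 2,
      `|vely z i| <= `|vely w i| /\ Num.sg (velx w i) = Num.sg (velx z i),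
      disk_reach d lam w i <= disk_reach d lam z i &
      posx w i = posx z i +
        Num.sg (velx z i) * (disk_reach d lam z i - disk_reach d lam w i)].

Lemma disk_reach_ge0 z i : in_channel d z -> vely z i != 0 ->
  0 <= disk_reach d lam z i.
Proof. by move=> yz vz; apply: reach_ge0. Qed.

Lemma advances_refl z i : vely z i != 0 -> advances z z i.
Proof. by move=> v0; split => //; rewrite subrr mulr0 addr0. Qed.

(** The clause on the sign of the horizontal velocity serves this composition: a disk that never
    turns back has displacements that add up. *)
Lemma advances_trans z w z' i :
  advances z w i -> advances w z' i -> advances z z' i.
Proof.
case=> _ e1 [v1 s1] r1 x1 [v0 e2 [v2 s2] r2 x2]; split => //.
- by rewrite e2.
- by split; [exact: le_trans v2 | rewrite s2].
- exact: le_trans r1.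
- by rewrite x2 x1 s1; ring.
Qed.

Lemma disk_reach_flight (s : R) z i : vely z i != 0 ->
  disk_reach d lam (free_flight s z) i = disk_reach d lam z i - s * `|velx z i|.
Proof. by move=> v0; rewrite /disk_reach /free_flight !coord_mk reach_flight. Qed.

Lemma advances_flight (s : R) z i : 0 <= s -> vely z i != 0 ->
  advances z (free_flight s z) i.
Proof.
move=> s0 v0; have r := disk_reach_flight s v0.
rewrite /advances r /free_flight !coord_mk; split => //.
  by rewrite gerBl mulr_ge0.
by rewrite subKr mulrCA -numEsg.
Qed.

(** A gap shrinks by at most the two displacements, that is, by at most what the two reaches
    lose. *)
Lemma advances_separated z w : in_channel d w -> moving w -> reach_separated d lam z ->
  (forall i, advances z w i) -> reach_separated d lam w.
Proof.
move=> yw vw sz zw i j ij; have := sz _ _ ij.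
have disp k : `|posx z k - posx w k| <= disk_reach d lam z k - disk_reach d lam w k.
  have [_ _ _ r ->] := zw k.
  rewrite opprD addNKr normrN normrM (ger0_norm (x := _ - _)) ?subr_ge0//.
  by rewrite ler_piMl ?subr_ge0// normr_sg lern1 leq_b1.
have := disp i; have := disp j.
have := circle_dist_lipschitz (posx z i) (posx z j) (posx w i) (posx w j).
lra.
Qed.

Lemma separated_dist z i j : in_channel d z -> moving z -> reach_separated d lam z ->
  i != j -> d < circle_dist (posx z i) (posx z j).
Proof.
move=> yz vz sz ij; apply: le_lt_trans (sz _ _ ij).
by rewrite -addrA lerDl addr_ge0// disk_reach_ge0.
Qed.

Lemma separated_centre_dist z i j : in_channel d z -> moving z ->
  reach_separated d lam z -> i != j -> d < centre_dist z i j.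
Proof.
move=> yz vz sz ij; have h := separated_dist yz vz sz ij.
apply: lt_le_trans h _; rewrite /centre_dist.
by rewrite -[leLHS]ger0_norm ?circle_dist_ge0// -sqrtr_sqr ler_wsqrtr// lerDl sqr_ge0.
Qed.

Lemma separated_not_touching z i j : in_channel d z -> moving z ->
  reach_separated d lam z -> ~ touching d z i j.
Proof.
by move=> yz vz sz [ij e]; have := separated_centre_dist yz vz sz ij; rewrite e ltxx.
Qed.

Lemma separated_admissible z : in_channel d z -> moving z -> reach_separated d lam z ->
  admissible d z.
Proof.
by move=> yz vz sz; split=> // i j ij; apply/ltW/separated_centre_dist.
Qed.

Lemma disk_reach_identified z w i : posy w i = posy z i ->
  wall_hit d z i -> wall_law lam (velx z i) (vely z i) (velx w i) (vely w i) ->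
  disk_reach d lam w i = disk_reach d lam z i.
Proof. by move=> e hit law; rewrite /disk_reach e; apply: reach_wall. Qed.

Lemma disk_reach_impact z w i : in_channel d z -> moving z -> reach_separated d lam z ->
  impact d lam z w -> disk_reach d lam w i = disk_reach d lam z i.
Proof.
move=> yz vz sz /(_ i)[ex ey []].
- by move=> _ _ eu ev; rewrite /disk_reach ey eu ev.
- by move=> hit _; apply: disk_reach_identified.
- by move=> j p _ [/(separated_not_touching yz vz sz)].
Qed.

Lemma advances_impact z w i : in_channel d z -> moving z -> reach_separated d lam z ->
  impact d lam z w -> advances z w i.
Proof.
move=> yz vz sz imp; have r := disk_reach_impact i yz vz sz imp.
have [ex ey] := imp i; rewrite /advances r ex subrr mulr0 addr0.
case=> [_ _ -> ->|_ _ law|j p _ [/(separated_not_touching yz vz sz)]//].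
  by split => //; apply: vz.
split => //.
- by case: (wall_vely_neq0 law).
- by case: law.
- by split; [exact: wall_vely_le law | exact: wall_sgr_velx law].
Qed.

(** The invariants and a further time-dependent property [Q] go through one real induction, so that
    [Q] has to be checked only for flights and impacts of separated states. In a flight it may also
    use that the state descends from [z a], for instance that [|v|] has not decreased. *)
Lemma trajectory_ind (Q : R -> state R n -> Prop) (T : \bar R) z0
    (z : R -> state R n) (a b : R) :
  trajectory d lam T z0 z -> 0 <= a -> a <= b -> (b%:E < T)%E ->
  moving (z a) -> reach_separated d lam (z a) ->
  Q a (z a) ->
  (forall t h w, in_channel d w -> moving w -> reach_separated d lam w -> 0 <= h ->
     (forall i, advances (z a) w i) -> Q t w -> Q (t + h) (free_flight h w)) ->
  (forall t w w', in_channel d w -> moving w -> reach_separated d lam w ->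
     impact d lam w w' -> Q t w -> Q t w') ->
  (forall i, advances (z a) (z b) i) /\ Q b (z b).
Proof.
move=> [_ adm right left] a0 ab bT va sa Qa Qflight Qimpact.
have chan t : a <= t <= b -> in_channel d (z t).
  move=> /andP[at_ tb]; case: (adm t) => //; first exact: le_trans at_.
  by apply: le_lt_trans bT; rewrite lee_fin.
apply: (@real_induction _
  (fun t => (forall i, advances (z a) (z t) i) /\ Q t (z t)) a b ab).
- by split=> // i; apply: advances_refl.
- move=> t /andP[at_ tb] [Pt Qt].
  have tT : (t%:E < T)%E by apply: le_lt_trans bT; rewrite lee_fin ltW.
  have yt : in_channel d (z t) by apply: chan; rewrite at_ ltW.
  have vt : moving (z t) by move=> i; case: (Pt i).
  have := right t (le_trans a0 at_) tT.
  apply: filterS2 (nbhs_right_gt t) => s ts ->; have st0 : 0 <= s - t by rewrite subr_ge0 ltW.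
  split=> [i|]; first by apply: (advances_trans (Pt i)); apply: advances_flight.
  rewrite -{1}(subrKC t s); apply: Qflight => //.
  exact: advances_separated Pt.
- move=> t /andP[at_ tb] Pt.
  have tT : (t%:E < T)%E by apply: le_lt_trans bT; rewrite lee_fin.
  have [z_ imp near_] := left t (le_lt_trans a0 at_) tT.
  (* Pick an earlier time [s] from which the disks fly freely up to the incoming state [z_]. What
     holds at [s] passes to [z_] by a flight, then to [z t] by the impact. *)
  have [s [[st zs] as_]] : exists s, (s < t /\ z s = free_flight (s - t) z_) /\ a <= s.
    apply: (@filter_ex _ (t^'-)); apply: filterI; last exact: nbhs_left_ge.
    by apply: filterI near_; apply: nbhs_left_lt.
  have [Ps Qs] : (forall i, advances (z a) (z s) i) /\ Q s (z s).
    by apply: Pt; rewrite as_.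
  have z_E : z_ = free_flight (t - s) (z s).
    by rewrite zs free_flightD -[LHS]free_flight0; congr free_flight; ring.
  have ys : in_channel d (z s) by apply: chan; rewrite as_ (ltW (lt_le_trans st tb)).
  have vs : moving (z s) by move=> i; case: (Ps i).
  have ts0 : 0 <= t - s by rewrite subr_ge0 ltW.
  have P_ i : advances (z a) z_ i.
    by apply: (advances_trans (Ps i)); rewrite z_E; apply: advances_flight.
  have v_ : moving z_ by move=> i; case: (P_ i).
  have y_ : in_channel d z_.
    move=> i; have [_ <- _] := imp i.
    by apply: chan; rewrite (ltW at_) tb.
  have s_ : reach_separated d lam z_ by exact: advances_separated P_.
  split=> [i|]; first by apply: (advances_trans (P_ i)); apply: advances_impact.
  apply: (Qimpact _ z_) => //; rewrite -(subrKC s t) z_E.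
  by apply: Qflight => //; exact: advances_separated Ps.
Qed.

Lemma trajectory_advances (T : \bar R) z0 (z : R -> state R n) (a b : R) :
  trajectory d lam T z0 z -> 0 <= a -> a <= b -> (b%:E < T)%E ->
  moving (z a) -> reach_separated d lam (z a) -> forall i, advances (z a) (z b) i.
Proof.
move=> traj a0 ab bT va sa.
by have [] := @trajectory_ind (fun _ _ => True) T z0 z a b.
Qed.

(** Evaluated at the initial state: as [|v|] never decreases, its initial value gives one rate for
    all later flights. *)
Definition decay_rate z i : R := `|vely z i| / (1 - d + tail d lam).

Lemma decay_rate_gt0 z i : vely z i != 0 -> 0 < decay_rate z i.
Proof.
by move=> v0; rewrite divr_gt0 ?normr_gt0// addr_gt0 ?subr_gt0// tail_gt0.
Qed.

(** A flight of duration [h] removes at least the fraction [decay_rate z i * h] of the reach, and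
    [1 - x <= exp (- x)]. The exponential form is the one that multiplies over successive flights,
    whatever their number. *)
Lemma disk_reach_flight_decay z w i (h : R) : in_channel d w -> vely w i != 0 ->
  `|vely z i| <= `|vely w i| -> 0 <= h ->
  disk_reach d lam (free_flight h w) i <=
  disk_reach d lam w i * expR (- decay_rate z i * h).
Proof.
move=> yw vw zw h0; have r0 := disk_reach_ge0 yw vw.
rewrite disk_reach_flight//.
apply: (@le_trans _ _ (disk_reach d lam w i * (1 + - decay_rate z i * h)));
  last by rewrite ler_wpM2l// expR_ge1Dx.
rewrite mulrDr mulr1 lerD2l mulNr mulrN lerN2 mulrA mulrC.
rewrite ler_wpM2l// /decay_rate mulrA ler_pdivrMr; last first.
  by rewrite addr_gt0 ?subr_gt0// tail_gt0.
by apply: le_trans (reach_rate _ _ vw (yw i)); rewrite ler_wpM2l.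
Qed.

Lemma disk_reach_decay (T : \bar R) z0 (z : R -> state R n) (t : R) i :
  trajectory d lam T z0 z -> 0 <= t -> (t%:E < T)%E ->
  moving (z 0) -> reach_separated d lam (z 0) ->
  disk_reach d lam (z t) i <=
  disk_reach d lam (z 0) i * expR (- decay_rate (z 0) i * t).
Proof.
move=> traj t0 tT v0 s0.
pose Q (t : R) w := disk_reach d lam w i <=
  disk_reach d lam (z 0) i * expR (- decay_rate (z 0) i * t).
have [|||_ //] := @trajectory_ind Q T z0 z 0 t traj (lexx 0) t0 tT v0 s0.
- by rewrite /Q mulr0 expR0 mulr1.
- move=> s h w yw vw sw h0 zw Qw; have [_ _ [zvw _] _ _] := zw i.
  apply: le_trans (disk_reach_flight_decay yw (vw i) zvw h0) _.
  by rewrite mulrDr expRD mulrA ler_wpM2r ?expR_ge0.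
- by move=> s w w' yw vw sw imp; rewrite /Q (disk_reach_impact i yw vw sw imp).
Qed.

(** The square root is the speed of the disk, which is conserved and bounds [|v|]; the division by
    [tail d lam] comes from [velx_le_reach]. *)
Lemma velx_decay (T : \bar R) z0 (z : R -> state R n) (t : R) i :
  trajectory d lam T z0 z -> 0 <= t -> (t%:E < T)%E ->
  moving (z 0) -> reach_separated d lam (z 0) ->
  `|velx (z t) i| <=
  disk_reach d lam (z 0) i *
    Num.sqrt (velx (z 0) i ^+ 2 + vely (z 0) i ^+ 2) / tail d lam *
    expR (- decay_rate (z 0) i * t).
Proof.
move=> traj t0 tT v0 s0.
have [vt et _ _ _] := trajectory_advances traj (lexx 0) t0 tT v0 s0 i.
have [yt _] : admissible d (z t) by case: traj => _ adm _ _; apply: adm.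
rewrite mulrAC ler_pdivlMr ?tail_gt0//.
apply: le_trans (velx_le_reach _ _ vt (yt i)) _; rewrite [leRHS]mulrAC.
apply: ler_pM => //; first exact: disk_reach_ge0.
  exact: disk_reach_decay traj t0 tT v0 s0.
by rewrite -et -sqrtr_sqr ler_wsqrtr// lerDr sqr_ge0.
Qed.

End Channel.

(** * Existence of the trajectory of a single disk *)

Section OneDiskTrajectory.
Variables (R : realType) (d lam : R).
Hypotheses (lam_gt0 : 0 < lam) (d_lt1 : d < 1).
Implicit Types z w : state R 1.

Lemma separated1 z : reach_separated d lam z.
Proof. by move=> i j; rewrite !ord1 eqxx. Qed.

Lemma no_disk_hit1 z i j p : ~ disk_hit d z i j p.
Proof. by case=> [[]]; rewrite !ord1 eqxx. Qed.

Lemma in_channel1 z : d / 2 <= posy z ord0 <= 1 - d / 2 -> in_channel d z.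
Proof. by move=> h i; rewrite ord1. Qed.

(* The common factor that restores the speed after [velx] has been multiplied
   by [expR (- lam)]. *)
Definition rescaling (u v : R) :=
  Num.sqrt ((u ^+ 2 + v ^+ 2) / ((expR (- lam) * u) ^+ 2 + v ^+ 2)).

Definition bounce z : state R 1 :=
  mk_state (posx z) (posy z)
    (fun i => rescaling (velx z i) (vely z i) * (expR (- lam) * velx z i))
    (fun i => - (rescaling (velx z i) (vely z i) * vely z i)).

Lemma bounce_law z i : vely z i != 0 ->
  wall_law lam (velx z i) (vely z i) (velx (bounce z) i) (vely (bounce z) i).
Proof.
rewrite /bounce !coord_mk; move: (velx z i) (vely z i) => u v v0.
have v2 : 0 < v ^+ 2 by rewrite exprn_even_gt0.
have den : 0 < (expR (- lam) * u) ^+ 2 + v ^+ 2 by rewrite ltr_wpDl ?sqr_ge0.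
have num : 0 < u ^+ 2 + v ^+ 2 by rewrite ltr_wpDl ?sqr_ge0.
have g0 : 0 < rescaling u v by rewrite sqrtr_gt0 divr_gt0.
split.
- have -> : v * - (rescaling u v * v) = - (rescaling u v * v ^+ 2) by ring.
  by rewrite oppr_lt0 mulr_gt0.
- have -> : (rescaling u v * (expR (- lam) * u)) ^+ 2 + (- (rescaling u v * v)) ^+ 2 =
     rescaling u v ^+ 2 * ((expR (- lam) * u) ^+ 2 + v ^+ 2) by ring.
  by rewrite sqr_sqrtr ?divr_ge0 ?ltW// divfK// gt_eqF.
- rewrite normrN normrM (gtr0_norm g0); field.
  by rewrite normr_eq0 v0 gt_eqF.
Qed.

(** The states from which a leg between two bounces may start; the last clause makes the time to the
    next wall strictly positive. *)
Definition outgoing z :=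
  [/\ in_channel d z, vely z ord0 != 0 & ~ wall_hit d z ord0].

Definition crossing_time z :=
  ahead d (posy z ord0) (vely z ord0) / `|vely z ord0|.

Lemma bounce_impact z : vely z ord0 != 0 -> wall_hit d z ord0 ->
  impact d lam z (bounce z).
Proof.
move=> v0 hit i; rewrite ord1; split; rewrite ?/bounce ?coord_mk//.
apply: WallImpact => //; first by move=> j p; apply: no_disk_hit1.
exact: bounce_law.
Qed.

Lemma no_impact z : ~ wall_hit d z ord0 -> impact d lam z z.
Proof.
move=> hit i; rewrite ord1; split=> //; apply: NoImpact => // j p.
exact: no_disk_hit1.
Qed.

Lemma bounce_outgoing z : in_channel d z -> vely z ord0 != 0 ->
  wall_hit d z ord0 ->
  outgoing (bounce z) /\
  ahead d (posy (bounce z) ord0) (vely (bounce z) ord0) = 1 - d.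
Proof.
move=> yz v0 hit; have law := bounce_law v0; have [_ v'0] := wall_vely_neq0 law.
have ey : posy (bounce z) ord0 = posy z ord0 by rewrite /bounce coord_mk.
case: law => vv' _ _; rewrite /outgoing /wall_hit ey.
have chan : in_channel d (bounce z) by apply: in_channel1; rewrite ey.
case: hit => -[-> v1]; move: vv'.
  rewrite nmulr_rlt0// => v'1; rewrite ahead_pos//; split; last by lra.
  split=> // -[[_ h]|[h _]]; first by rewrite ltNge ltW in h.
  by move: d_lt1 h; lra.
rewrite pmulr_rlt0// => v'1; rewrite ahead_neg//; split; last by lra.
split=> // -[[h _]|[_ h]]; last by rewrite ltNge ltW in h.
by move: d_lt1 h; lra.
Qed.

Lemma crossing_time_gt0 z : outgoing z -> 0 < crossing_time z.
Proof.
case=> /(_ ord0)/andP[y1 y2] v0 hit; rewrite divr_gt0 ?normr_gt0//.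
rewrite /wall_hit in hit.
move: v0; rewrite neq_lt => /orP[] v0; [rewrite ahead_neg|rewrite ahead_pos] => //.
  rewrite subr_gt0 lt_neqAle y1 andbT; apply/eqP => e; apply: hit.
  by left.
rewrite subr_gt0 lt_neqAle y2 andbT; apply/eqP => e; apply: hit.
by right.
Qed.

Lemma flight_in_channel z (h : R) : in_channel d z -> vely z ord0 != 0 ->
  0 <= h <= crossing_time z -> in_channel d (free_flight h z).
Proof.
move=> /(_ ord0)/andP[y1 y2] v0 /andP[h0]; rewrite ler_pdivlMr ?normr_gt0// => h1.
apply: in_channel1; rewrite /free_flight coord_mk.
move: v0; rewrite neq_lt => /orP[] v0; move: h1.
  rewrite ahead_neg// ltr0_norm// => h1.
  have h2 : h * vely z ord0 <= 0 by rewrite mulr_ge0_le0// ltW.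
  by apply/andP; split; lra.
rewrite ahead_pos// gtr0_norm// => h1.
have h2 : 0 <= h * vely z ord0 by rewrite mulr_ge0// ltW.
by apply/andP; split; lra.
Qed.

Lemma flight_no_hit z (h : R) : vely z ord0 != 0 -> h < crossing_time z ->
  ~ wall_hit d (free_flight h z) ord0.
Proof.
move=> v0; rewrite ltr_pdivlMr ?normr_gt0//.
rewrite /wall_hit /free_flight !coord_mk.
move: v0; rewrite neq_lt => /orP[] v0.
  by rewrite ahead_neg// ltr0_norm// => h1 -[[e _]|[_ e]]; move: h1 e d_lt1 v0; lra.
by rewrite ahead_pos// gtr0_norm// => h1 -[[_ e]|[e _]]; move: h1 e d_lt1 v0; lra.
Qed.

Lemma flight_hit z : vely z ord0 != 0 ->
  wall_hit d (free_flight (crossing_time z) z) ord0.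
Proof.
move=> v0; have : crossing_time z * `|vely z ord0| =
    ahead d (posy z ord0) (vely z ord0) by rewrite divfK// normr_eq0.
rewrite /wall_hit /free_flight !coord_mk.
move: v0; rewrite neq_lt => /orP[] v0.
  by rewrite ahead_neg// ltr0_norm// => h1; left; split=> //; lra.
by rewrite ahead_pos// gtr0_norm// => h1; right; split=> //; lra.
Qed.

Section Flow.
Variable a0 : state R 1.
Hypothesis a0_out : outgoing a0.

Fixpoint bounces k : state R 1 :=
  if k is k'.+1 then
    bounce (free_flight (crossing_time (bounces k')) (bounces k'))
  else a0.

Definition hit_time k := \sum_(j < k) crossing_time (bounces j).

Let last_flight k := free_flight (crossing_time (bounces k)) (bounces k).

Lemma bouncesP k : outgoing (bounces k) /\
  ahead d (posy (bounces k.+1) ord0) (vely (bounces k.+1) ord0) = 1 - d.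
Proof.
have step z : outgoing z -> outgoing (bounce (free_flight (crossing_time z) z)) /\
    ahead d (posy (bounce (free_flight (crossing_time z) z)) ord0)
      (vely (bounce (free_flight (crossing_time z) z)) ord0) = 1 - d.
  move=> out; have [yz v0 _] := out; apply: bounce_outgoing; last exact: flight_hit.
    by apply: flight_in_channel; rewrite ?lexx ?andbT// ltW// crossing_time_gt0.
  by rewrite /free_flight coord_mk.
have out : outgoing (bounces k) by elim: k => [|k /step[]].
by split=> //; case: (step _ out).
Qed.

Lemma bounces_speed k :
  velx (bounces k) ord0 ^+ 2 + vely (bounces k) ord0 ^+ 2 =
  velx a0 ord0 ^+ 2 + vely a0 ord0 ^+ 2.
Proof.
elim: k => // k <-; have [[_ v0 _] _] := bouncesP k.
have [_ -> _] : wall_law lam (velx (last_flight k) ord0) (vely (last_flight k) ord0)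
    (velx (bounces k.+1) ord0) (vely (bounces k.+1) ord0).
  by apply: bounce_law; rewrite /last_flight /free_flight coord_mk.
by rewrite /last_flight /free_flight !coord_mk.
Qed.

Lemma hit_timeS k : hit_time k.+1 = hit_time k + crossing_time (bounces k).
Proof. by rewrite /hit_time big_ord_recr. Qed.

Lemma hit_time_ltS k : hit_time k < hit_time k.+1.
Proof. by rewrite hit_timeS ltrDl crossing_time_gt0//; case: (bouncesP k). Qed.

Lemma hit_time_le k l : (k <= l)%N -> hit_time k <= hit_time l.
Proof.
elim: l => [|l IH]; first by rewrite leqn0 => /eqP ->.
by rewrite leq_eqVlt => /predU1P[->//|/IH /le_trans]; apply; exact/ltW/hit_time_ltS.
Qed.

(** Bounces cannot accumulate: after the first one every leg crosses the full height [1 - d], at a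
    vertical speed bounded by the conserved speed [s]. *)
Lemma hit_time_unbounded (t : R) : exists k, t < hit_time k.+1.
Proof.
pose s := Num.sqrt (velx a0 ord0 ^+ 2 + vely a0 ord0 ^+ 2).
have s0 : 0 < s.
  case: a0_out => _ v0 _.
  by rewrite sqrtr_gt0 ltr_wpDl ?sqr_ge0// exprn_even_gt0.
pose c := (1 - d) / s; have c0 : 0 < c by rewrite divr_gt0// subr_gt0.
(* The index is shifted by one because the leg from [a0] may start close to a wall and be
   arbitrarily short. *)
have lower k : k%:R * c <= hit_time k.+1.
  elim: k => [|k IH].
    by rewrite mul0r hit_timeS /hit_time big_ord0 add0r ltW// crossing_time_gt0.
  rewrite hit_timeS -natr1 mulrDl mul1r lerD//.
  have [[_ v0 _] _] := bouncesP k.+1; have [_ ah] := bouncesP k.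
  rewrite /crossing_time ah /c ler_wpM2l ?subr_ge0 ?(ltW d_lt1)//.
  rewrite lef_pV2 ?posrE ?normr_gt0// /s -(bounces_speed k.+1).
  by rewrite -sqrtr_sqr ler_wsqrtr// lerDr sqr_ge0.
exists (Num.bound (`|t| / c)); apply: lt_le_trans (lower _).
rewrite -ltr_pdivrMr//; apply: le_lt_trans (archi_boundP _).
  by rewrite ler_wpM2r ?invr_ge0 ?(ltW c0)// ler_norm.
by rewrite divr_ge0// ltW.
Qed.

Definition in_leg t k := hit_time k <= t < hit_time k.+1.

Lemma in_leg_ex t : 0 <= t -> exists k, in_leg t k.
Proof.
move=> t0; have [k tk kmin] := ex_minnP (hit_time_unbounded t).
exists k; rewrite /in_leg tk andbT; case: k tk kmin => [|k] _ kmin.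
  by rewrite /hit_time big_ord0.
by rewrite leNgt; apply/negP => /kmin; rewrite ltnn.
Qed.

Lemma in_leg_inj t k l : in_leg t k -> in_leg t l -> k = l.
Proof.
move=> /andP[k1 k2] /andP[l1 l2].
case: (ltngtP k l) => // /hit_time_le; rewrite leNgt => /negP[].
  exact: le_lt_trans l1 k2.
exact: le_lt_trans k1 l2.
Qed.

(** Legs are closed on the left, so at a hit time the flow takes the outgoing velocity, as
    [trajectory] demands. Negative times lie in no leg and get the default leg 0. *)
Definition flow (t : R) : state R 1 :=
  let k := xget 0%N [set k | in_leg t k] in
  free_flight (t - hit_time k) (bounces k).

Lemma flowE t k : in_leg t k -> flow t = free_flight (t - hit_time k) (bounces k).
Proof.
move=> tk; rewrite /flow; case: xgetP => [l _ /= tl|/(_ k)//].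
by rewrite (in_leg_inj tk tl).
Qed.

Lemma flow_trajectory z0 : impact d lam z0 a0 -> trajectory d lam +oo z0 flow.
Proof.
move=> imp; split.
- have h0 : hit_time 0 = 0 by rewrite /hit_time big_ord0.
  rewrite (@flowE 0 0%N); first by rewrite h0 subrr free_flight0.
  by rewrite /in_leg h0 lexx -h0 hit_time_ltS.
- move=> t /in_leg_ex[k tk] _; rewrite (flowE tk); move: tk; rewrite /in_leg hit_timeS.
  move=> /andP[k1 k2]; have [[yk vk _] _] := bouncesP k.
  apply: (@separated_admissible _ _ _ lam) => //; last exact: separated1.
    apply: flight_in_channel => //; rewrite subr_ge0 k1/= lerBlDl.
    exact: ltW.
  by move=> i; rewrite ord1 /free_flight coord_mk.
- move=> t /in_leg_ex[k tk] _; have /andP[k1 k2] := tk.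
  apply: filterS2 (nbhs_right_gt t) (nbhs_right_lt k2) => s ts sk.
  have sk' : in_leg s k by rewrite /in_leg (le_trans k1 (ltW ts)) sk.
  by rewrite (flowE tk) (flowE sk') free_flightD; congr free_flight; ring.
- move=> t t0 _; have [k tk] := in_leg_ex (ltW t0); have /andP[k1 k2] := tk.
  have [[yk vk hk] _] := bouncesP k.
  have [kt|] := ltP (hit_time k) t.
    exists (flow t).
      apply: no_impact; rewrite (flowE tk); apply: flight_no_hit => //.
      by rewrite ltrBlDl -hit_timeS.
    apply: filterS2 (nbhs_left_lt t) (nbhs_left_gt kt) => s st ks.
    have sk : in_leg s k by rewrite /in_leg (ltW ks) (lt_trans st k2).
    by rewrite (flowE tk) (flowE sk) free_flightD; congr free_flight; ring.
  (* Here [t] is the start of a leg: the incoming state is the end of the previous flight. Leg 0 has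
     none, but it starts at time 0 and [t] is positive. *)
  move=> tk'; have tE : t = hit_time k by apply/le_anti; rewrite tk' k1.
  case: k tk k1 k2 yk vk hk tk' tE => [|k] tk k1 k2 yk vk hk tk' tE.
    by move: t0; rewrite tE /hit_time big_ord0 ltxx.
  have [[yk' vk' hk'] _] := bouncesP k.
  exists (free_flight (crossing_time (bounces k)) (bounces k)).
    rewrite (flowE tk) tE subrr free_flight0; apply: bounce_impact; last exact: flight_hit.
    by rewrite /free_flight coord_mk.
  have kt : hit_time k < t by rewrite tE hit_time_ltS.
  apply: filterS2 (nbhs_left_lt t) (nbhs_left_gt kt) => s st ks.
  have sk : in_leg s k by rewrite /in_leg (ltW ks) -tE.
  rewrite (flowE sk) free_flightD; congr free_flight.
  by rewrite tE hit_timeS; ring.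
Qed.

End Flow.

Lemma one_disk_trajectory z0 : in_channel d z0 -> vely z0 ord0 != 0 ->
  exists z : R -> state R 1, trajectory d lam +oo z0 z.
Proof.
move=> y0 v0; have [hit|hit] := pselect (wall_hit d z0 ord0).
  exists (flow (bounce z0)); apply: flow_trajectory; last exact: bounce_impact.
  by case: (bounce_outgoing y0 v0 hit).
by exists (flow z0); apply: flow_trajectory; [split | exact: no_impact].
Qed.

End OneDiskTrajectory.

(** * The total displacement is the reach *)

Section TotalDisplacement.
Variables (R : realType) (d lam : R).
Hypotheses (lam_gt0 : 0 < lam) (d_lt1 : d < 1).

Lemma exp_decay_le (r c e : R) : 0 <= r -> 0 < c -> 0 < e ->
  (* The threshold comes from the crude bound [c * t <= expR (c * t)]. *)
  exists2 T, 0 <= T & forall t, T <= t -> r * expR (- c * t) <= e.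
Proof.
move=> r0 c0 e0; exists (r / (c * e)) => [|t Tt].
  by rewrite divr_ge0// ltW// mulr_gt0.
have h : r <= e * (c * t) by move: Tt; rewrite ler_pdivrMr ?mulr_gt0//; lra.
rewrite mulNr expRN ler_pdivrMr ?expR_gt0//; apply: le_trans h _.
by rewrite ler_pM2l// (le_trans _ (expR_ge1Dx _))// lerDr.
Qed.

(** Such an [x] is monotone, so its variation is its net displacement; motion to the left is
    reflected to become nondecreasing. *)
Lemma total_variation_sgr (x r : R -> R) (x0 s r0 T : R) : 0 <= T ->
  {in `[0, T] &, forall a b, a <= b -> r b <= r a} ->
  {in `[0, T], forall t, x t = x0 + Num.sg s * (r0 - r t)} ->
  total_variation 0 T x = (`|Num.sg s| * (r 0 - r T))%:E.
Proof.
move=> T0 mono xE.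
have in0 : 0 \in `[0, T] by rewrite in_itv/= lexx.
have inT : T \in `[0, T] by rewrite in_itv/= lexx T0.
have main b : (-1) ^+ b * Num.sg s = `|Num.sg s| ->
    total_variation 0 T (fun t => (-1) ^+ b * x t) = (`|Num.sg s| * (r 0 - r T))%:E.
  move=> sb; rewrite nondecreasing_total_variation//.
    by congr _%:E; rewrite !xE// -sb; ring.
  move=> u v u0 v0 uv; rewrite -subr_ge0 !xE//.
  have -> : (-1) ^+ b * (x0 + Num.sg s * (r0 - r v)) -
    (-1) ^+ b * (x0 + Num.sg s * (r0 - r u)) = ((-1) ^+ b * Num.sg s) * (r u - r v).
    by ring.
  by rewrite sb mulr_ge0// subr_ge0 mono.
have [s0|s0] := leP 0 s.
  rewrite -(main false); last by rewrite expr0 mul1r ger0_norm// sgr_ge0.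
  by congr total_variation; apply/funext => t; rewrite expr0 mul1r.
rewrite -(main true); last by rewrite expr1 mulN1r ltr0_norm// sgr_lt0.
rewrite -total_variationN.
by congr total_variation; apply/funext => t; rewrite expr1 mulN1r.
Qed.

Lemma total_displacementE n (z : state R n) i :
  in_channel d z -> vely z i != 0 ->
  total_displacement d lam z i = (disk_reach d lam z i)%:E.
Proof.
move=> yz vz; pose z0 : state R 1 := row i z.
have [px py vx vy] : [/\ posx z0 ord0 = posx z i, posy z0 ord0 = posy z i,
    velx z0 ord0 = velx z i & vely z0 ord0 = vely z i].
  by split; rewrite /z0 /posx /posy /velx /vely mxE.
have rE : disk_reach d lam z0 ord0 = disk_reach d lam z i.
  by rewrite /disk_reach py vx vy.
have y0 : in_channel d z0 by apply: in_channel1; rewrite py.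
have v0 : moving z0 by move=> j; rewrite ord1 vy.
have r_ge0 : 0 <= disk_reach d lam z i by apply: disk_reach_ge0.
have key w T : trajectory d lam +oo z0 w -> 0 <= T ->
    [/\ total_variation 0 T (fun t => posx (w t) ord0) =
          (disk_reach d lam z i - disk_reach d lam (w T) ord0)%:E,
        0 <= disk_reach d lam (w T) ord0 &
        disk_reach d lam (w T) ord0 <= disk_reach d lam z i *
          expR (- decay_rate d lam (w 0) ord0 * T)].
  move=> traj T0; have [imp adm _ _] := traj.
  have /= sep0 := @separated1 _ d lam.
  have w0 j := advances_impact lam_gt0 d_lt1 j y0 v0 (sep0 _) imp.
  have r0 := disk_reach_impact lam_gt0 d_lt1 ord0 y0 v0 (sep0 _) imp.
  have vw0 : moving (w 0) by move=> j; case: (w0 j).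
  have adv a b : 0 <= a -> a <= b -> moving (w a) -> advances d lam (w a) (w b) ord0.
    move=> a0 ab va; apply: trajectory_advances traj _ _ _ _ _ _ => //.
    by rewrite ltry.
  have vw t : 0 <= t -> moving (w t).
    by move=> t0 j; rewrite ord1; case: (adv 0 t (lexx 0) t0 vw0).
  have yw t : 0 <= t -> in_channel d (w t).
    by move=> t0; case: (adm t t0) => //; rewrite ltry.
  have rT0 : 0 <= disk_reach d lam (w T) ord0.
    by apply: disk_reach_ge0 => //; [exact: yw | exact: vw].
  split => //; last first.
    rewrite -rE -r0; apply: disk_reach_decay traj _ _ _ _ => //.
    by rewrite ltry.
  rewrite (@total_variation_sgr _ (fun t => disk_reach d lam (w t) ord0)
    (posx (w 0) ord0) (velx (w 0) ord0) (disk_reach d lam (w 0) ord0))//; first last.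
  - move=> t; rewrite in_itv/= => /andP[t0 _].
    by case: (adv 0 t (lexx 0) t0 vw0).
  - move=> a b; rewrite !in_itv/= => /andP[a0 _] /andP[b0 _] ab.
    by case: (adv a b a0 ab (vw a a0)).
  (* The factor [|Num.sg u|] is 1 unless [u = 0], and then both reaches vanish. *)
  congr _%:E; rewrite r0 rE normr_sg; have [u0|_] := eqVneq; last by rewrite mul1r.
  rewrite mul0r; have : disk_reach d lam (w T) ord0 <= disk_reach d lam (w 0) ord0.
    by case: (adv 0 T (lexx 0) T0 vw0).
  have -> : disk_reach d lam (w 0) ord0 = 0.
    by rewrite /disk_reach u0 /reach normr0 !mul0r.
  move: (r0); rewrite rE /disk_reach u0 {1}/reach normr0 !mul0r => <- ?.
  by apply/esym/eqP; rewrite sub0r oppr_eq0 eq_le rT0 andbT.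
apply/le_anti/andP; split.
  apply: ge_ereal_sup => _ [w [T [traj T0 ->]]].
  have [-> rT _] := key w T traj T0.
  by rewrite lee_fin gerBl.
(* For the lower bound one trajectory is enough: followed long enough, it leaves a remaining reach
   below any given [e]. *)
have [w traj] := one_disk_trajectory lam_gt0 d_lt1 y0 (v0 ord0).
have c0 : 0 < decay_rate d lam (w 0) ord0.
  have [imp _ _ _] := traj; apply: decay_rate_gt0 => //.
  by case: (advances_impact lam_gt0 d_lt1 ord0 y0 v0 (@separated1 _ d lam _) imp).
apply/lee_addgt0Pr => e e0; have [T T0 small] := exp_decay_le r_ge0 c0 e0.
have [tv _ dec] := key w T traj T0.
rewrite -leeBlDr//; apply: le_trans (_ : total_variation 0 T (fun t => posx (w t) ord0) <= _)%E.
  rewrite tv lee_fin lerD2l lerN2; exact: le_trans dec (small T (lexx T)).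
by apply: ereal_sup_ubound; exists w, T.
Qed.

End TotalDisplacement.

(** * Openness in the phase space *)

Section PhaseOpen.
Variables (R : realType) (n : nat) (d lam m E : R).
Hypotheses (lam_gt0 : 0 < lam) (d_lt1 : d < 1).
Implicit Types (z w : state R n) (i j : 'I_n).

Lemma non_collidingE z : non_colliding d lam m E z <->
  [/\ phase_space d m E z, moving z & reach_separated d lam z].
Proof.
have key : phase_space d m E z -> moving z -> forall i j : 'I_n,
    (d%:E + total_displacement d lam z i + total_displacement d lam z j <
     (circle_dist (posx z i) (posx z j))%:E)%E =
    (d + disk_reach d lam z i + disk_reach d lam z j <
     circle_dist (posx z i) (posx z j)).
  by move=> [[yz _] _] vz i j; rewrite !total_displacementE.
by split=> -[ph vz sz]; split=> // i j ij; have := sz i j ij; rewrite key.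
Qed.

Lemma identified_circle_dist z w i j : identified d lam z w ->
  circle_dist (posx w i) (posx w j) = circle_dist (posx z i) (posx z j).
Proof.
by move=> id; have [[k ->] _ _] := id i; have [[l ->] _ _] := id j;
  rewrite circle_dist_shift.
Qed.

Lemma identified_non_colliding z w : identified d lam z w ->
  non_colliding d lam m E z <-> non_colliding d lam m E w.
Proof.
move=> id; rewrite !non_collidingE.
have cd i j := identified_circle_dist i j id.
have ey i : posy w i = posy z i by case: (id i).
have ev i : velx w i ^+ 2 + vely w i ^+ 2 = velx z i ^+ 2 + vely z i ^+ 2.
  by case: (id i) => _ _ [[-> ->]|[_ []]].
have er i : disk_reach d lam w i = disk_reach d lam z i.
  case: (id i) => _ _ [[eu ev']|[hit law]]; last exact: disk_reach_identified.
  by rewrite /disk_reach ey eu ev'.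
have e0 i : (vely w i != 0) = (vely z i != 0).
  case: (id i) => _ _ [[_ ->//]|[_ /wall_vely_neq0[-> ->//]]].
have ek : kinetic_energy m w = kinetic_energy m z.
  by congr (_ * _); apply: eq_bigr => i _.
have ec i j : centre_dist w i j = centre_dist z i j.
  by rewrite /centre_dist cd !ey.
rewrite /phase_space /admissible /moving /reach_separated /= ek.
split=> -[[[h1 h2] h3] h4 h5]; (split; [split; [split|]| |]) => //.
- by move=> i; rewrite ey.
- by move=> i j ij; rewrite ec h2.
- by move=> i; rewrite e0.
- by move=> i j ij; rewrite !er cd h5.
- by move=> i; rewrite -ey.
- by move=> i j ij; rewrite -ec h2.
- by move=> i; rewrite -e0.
- by move=> i j ij; rewrite -!er -cd h5.
Qed.

(** Writing the direction as [v / |v|] in [ahead] makes the reach a single formula, continuous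
    wherever [v] is nonzero. *)
Lemma disk_reach_cvg (z : 'M[R]_(n, 4)) i : vely z i != 0 ->
  (fun w : 'M[R]_(n, 4) => disk_reach d lam w i) @ z --> disk_reach d lam z i.
Proof.
move=> v0.
have cx k : (fun w : 'M[R]_(n, 4) => w i k) @ z --> z i k by exact: coord_continuous.
pose proof (cvgB (cvg_cst (2^-1 : R)) (cx (inord 1))) as cy.
pose proof (cvg_norm (cx (inord 2))) as cu.
have cv := cx (inord 3).
have av0 : `|z i (inord 3)| != 0 by rewrite normr_eq0.
pose proof (cvgV av0 (cvg_norm cv)) as civ.
pose proof (cvgM (cvgM cu civ)
  (cvgD (cvgD (cvgM cy (cvgM cv civ)) (cvg_cst ((1 - d) / 2))) (cvg_cst (tail d lam)))) as h.
exact: h.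
Qed.

Lemma open_reach_separated :
  open [set z : state R n | moving z /\ reach_separated d lam z].
Proof.
rewrite openE => z [vz sz]; rewrite /interior.
suff : nbhs (z : 'M[R]_(n, 4)) [set w : 'M[R]_(n, 4) |
  @moving R n w /\ @reach_separated R n d lam w] by [].
have cx i k : (fun w : 'M[R]_(n, 4) => w i k) @ (z : 'M[R]_(n, 4)) --> z i k.
  exact: coord_continuous.
have hv i : nbhs (z : 'M[R]_(n, 4)) [set w : 'M[R]_(n, 4) | w i (inord 3) != 0].
  by pose proof (cvgr_neq0 _ (cx i (inord 3)) (vz i)).
suff hs i j : nbhs (z : 'M[R]_(n, 4)) [set w : 'M[R]_(n, 4) | i != j ->
    d + disk_reach d lam w i + disk_reach d lam w j <
    circle_dist (posx w i) (posx w j)].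
  pose proof (filter_forall _ (fun i => filter_forall _ (hs i))) as hs'.
  exact: (filterI (filter_forall _ hv) hs').
have [<-|ij] := eqVneq i j; first by apply: filterE => w; rewrite /= ?eqxx.
(* By the Lipschitz bound, the slack of the pair at [w] is at least the slack computed with the gap
   at [z], minus the two horizontal shifts. That lower bound is continuous in [w] and positive at
   [z]. *)
pose proof (fun k => cvg_norm (cvgB (cvg_cst (posx z k)) (cx k (inord 0)))) as cdk.
pose proof (cvgB (cvg_cst (circle_dist (posx z i) (posx z j) - d))
  (cvgD (cvgD (cvgD (cdk i) (cdk j)) (disk_reach_cvg (vz i))) (disk_reach_cvg (vz j)))) as cf.
move/cvgr_gt: cf => /(_ 0); rewrite /posx !subrr normr0.
have h : 0 < circle_dist (z i (inord 0)) (z j (inord 0)) - d -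
    (0 + 0 + disk_reach d lam z i + disk_reach d lam z j).
  by have := sz i j ij; rewrite /posx; lra.
move=> /(_ h); apply: filterS => w; rewrite !fctE /= => hw _.
have := circle_dist_lipschitz (posx z i) (posx z j) (posx w i) (posx w j).
by move: hw; rewrite /posx; lra.
Qed.

Lemma phase_open_non_colliding : phase_open d lam m E (non_colliding d lam m E : set (state R n)).
Proof.
split; first by move=> z w; apply: identified_non_colliding.
exists [set z : state R n | moving z /\ reach_separated d lam z].
  exact: open_reach_separated.
apply/seteqP; split=> z; first by case/non_collidingE.
by move=> [ph [vz sz]]; apply/non_collidingE.
Qed.

End PhaseOpen.

(** * Lower bounds for the iterated Lebesgue measure *)

Section Measure.
Variable R : realType.

(* The usual monotonicity lemma needs measurable functions; nothing is known
   about the measurability of the sections of a phase set. *)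
Lemma le_integralT (f g : measurableTypeR R -> \bar R) :
  (forall x, 0 <= f x)%E -> (forall x, f x <= g x)%E ->
  (\int[@lebesgue_measure R]_x f x <= \int[@lebesgue_measure R]_x g x)%E.
Proof.
move=> f0 fg; have g0 x : (0 <= g x)%E by exact: le_trans (fg x).
rewrite !ge0_integralTE//; apply: le_ereal_sup => _ [h hf <-].
by exists h => // x; exact: le_trans (hf x) (fg x).
Qed.

Lemma lebesgue_tuple_ge0 k (A : set (k.-tuple (measurableTypeR R))) :
  (0 <= lebesgue_tuple A)%E.
Proof.
elim: k A => [A|k IH A] /=; first exact: measure_ge0.
rewrite /pushforward /product_measure1; apply: integral_ge0 => x _; exact: IH.
Qed.

(** Over the first side of the cube every section of [A] contains a cube of one dimension less, and
    elsewhere its measure is at least 0; comparing integrals gives the bound for an arbitrary set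
    [A]. *)
Lemma lebesgue_tuple_cube k (L : 'I_k -> R) (e : R)
    (A : set (k.-tuple (measurableTypeR R))) : 0 <= e ->
  (forall t : k.-tuple (measurableTypeR R),
     (forall j, L j <= tnth t j <= L j + e) -> A t) ->
  ((e ^+ k)%:E <= lebesgue_tuple A)%E.
Proof.
move=> e0; elim: k L A => [L A h|k IH L A h] /=.
  have -> : A = setT.
    by apply/seteqP; split=> // t _; apply: h => -[].
  by rewrite diracT.
rewrite /pushforward /product_measure1.
set B := _ @^-1` A.
have sec x : L ord0 <= x <= L ord0 + e ->
    ((e ^+ k)%:E <= lebesgue_tuple (xsection B x))%E.
  move=> xL; apply: (IH (fun j => L (lift ord0 j))) => t tL.
  rewrite /xsection /= inE /B /=; apply: h => j.
  by have [i ->|->] := unliftP ord0 j; rewrite ?tnthS ?tnth0.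
pose I := `[L ord0, L ord0 + e]%classic : set (measurableTypeR R).
apply: (@le_trans _ _ (\int[@lebesgue_measure R]_x (e ^+ k * \1_I x)%:E)%E); last first.
  apply: le_integralT => x.
    by rewrite lee_fin mulr_ge0// exprn_ge0.
  rewrite indicE; have [xI|xI] := boolP (x \in I); last first.
    by rewrite mulr0 lebesgue_tuple_ge0.
  by rewrite mulr1; apply: sec; move: xI; rewrite inE /I /= in_itv.
have mI : measurable I by exact: measurable_itv.
rewrite (integralZl_indic _ (fun=> I))//; last by rewrite ltNge exprn_ge0.
have lI : @lebesgue_measure R I = e%:E.
  apply: etrans (lebesgue_measure_itv `[L ord0, L ord0 + e]) _.
  rewrite /= lte_fin ltrDl.
  have [_|e1] := ltP 0 e; first by rewrite -EFinD addrC addKr.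
  by congr _%:E; apply/le_anti; rewrite e0 e1.
rewrite integral_indic// setIT; set q := (X in (_ * X)%E).
by have -> : q = e%:E := lI; rewrite -EFinM exprSr.
Qed.

End Measure.

(** * Positive measure *)

Lemma int_shift_neq0 (n : nat) (i j : 'I_n) (k : int) : i != j ->
  i%:Z - j%:Z + k * n%:Z != 0.
Proof.
move=> ij; have ij' : (i : nat) <> j by move=> /val_inj/eqP; rewrite (negbTE ij).
have := ltn_ord i; have := ltn_ord j; move: (i : nat) (j : nat) ij' => {ij}i {}j ij.
move=> jn iN; have [k1|[->|k1]] : k <= -1 \/ k = 0 \/ 1 <= k by lia.
- have : k * n%:Z <= -1 * n%:Z by rewrite ler_wpM2r.
  by lia.
- by lia.
- have : 1 * n%:Z <= k * n%:Z by rewrite ler_wpM2r.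
  by lia.
Qed.

Section PositiveMeasure.
Variables (R : realType) (N : nat) (d lam m E : R).
Hypotheses (N_ge2 : (2 <= N)%N) (lam_gt0 : 0 < lam) (d_gt0 : 0 < d)
  (d_ltN : d < N%:R^-1) (m_gt0 : 0 < m) (E_gt0 : 0 < E).
Implicit Types (z w : state R N) (i j : 'I_N).

Let N_gt0 : 0 < N%:R :> R.
Proof. by rewrite ltr0n; case: N N_ge2. Qed.

Lemma diameter_lt_half : d < 2^-1.
Proof.
apply: lt_le_trans d_ltN _.
by rewrite lef_pV2 ?posrE// ler_nat.
Qed.

Lemma diameter_lt1 : d < 1.
Proof. by apply: lt_trans diameter_lt_half _; rewrite invf_lt1// ltr1n. Qed.

(** Since [i - j] is not a multiple of [N], distinct grid points are at least [1 / N] apart on the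
    circle, and two offsets in [[0, e]] differ by at most [e]. *)
Lemma circle_dist_grid i j (a b e : R) : i != j -> 0 <= a <= e -> 0 <= b <= e ->
  N%:R^-1 - e <= circle_dist (i%:R / N%:R + a) (j%:R / N%:R + b).
Proof.
move=> ij /andP[a0 ae] /andP[b0 be]; apply: circle_dist_ge => k.
pose p : int := i%:Z - j%:Z + k * N%:Z.
have p0 : p != 0 by exact: int_shift_neq0.
have p1 : 1 <= `|p%:~R : R| by rewrite -intr_norm ler1z -gtz0_ge1 normr_gt0.
have -> : i%:R / N%:R + a - (j%:R / N%:R + b) + k%:~R = p%:~R / N%:R - (b - a).
  rewrite /p rmorphD rmorphB rmorphM/= -!pmulrn; field.
  by rewrite gt_eqF.
apply: le_trans (lerB_dist _ _).
apply: lerB.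
  by rewrite normrM normfV (gtr0_norm N_gt0) ler_peMl// invr_ge0 ltW.
by rewrite ler_norml; apply/andP; split; lra.
Qed.

Lemma disk_reach_scale (c : R) z i : 0 < c ->
  disk_reach d lam (mk_state (posx z) (posy z) (fun i => c * velx z i)
    (fun i => c * vely z i)) i = disk_reach d lam z i.
Proof.
move=> c0; rewrite /disk_reach !coord_mk /reach /ahead !normrM (gtr0_norm c0).
by rewrite -!mulf_div divff ?gt_eqF// !mul1r.
Qed.

(** [phase_measure] sees a set through the cone over it. All conditions but the energy are invariant
    under scaling the velocities, and the energy is quadratic, whence the factor [r]. *)
Lemma non_colliding_cone w : in_channel d w -> moving w ->
  reach_separated d lam w -> 0 < kinetic_energy m w <= E ->
  exists (r : R) z, [/\ 0 < r <= 1, non_colliding d lam m E z &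
    w = mk_state (posx z) (posy z) (fun i => r * velx z i) (fun i => r * vely z i)].
Proof.
move=> yw vw sw /andP[K0 KE].
pose r := Num.sqrt (kinetic_energy m w / E).
have r0 : 0 < r by rewrite sqrtr_gt0 divr_gt0.
have r1 : r <= 1 by rewrite -[leRHS]sqrtr1 ler_wsqrtr// ler_pdivrMr// mul1r.
pose z : state R N := mk_state (posx w) (posy w) (fun i => r^-1 * velx w i)
  (fun i => r^-1 * vely w i).
exists r, z; split; first by rewrite r0.
- have rV0 : 0 < r^-1 by rewrite invr_gt0.
  have yz : in_channel d z by move=> i; rewrite /z coord_mk.
  have vz : moving z.
    by move=> i; rewrite /z coord_mk mulf_neq0 ?vw ?gt_eqF.
  have sz : reach_separated d lam z.
    by move=> i j ij; rewrite /z !disk_reach_scale// !coord_mk sw.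
  apply/(non_collidingE _ _ lam_gt0 diameter_lt1).
  split=> //; split; first exact: (separated_admissible lam_gt0 diameter_lt1).
  rewrite /kinetic_energy (eq_bigr (fun i => r^-1 ^+ 2 * (velx w i ^+ 2 + vely w i ^+ 2))).
    rewrite -mulr_sumr mulrCA -/(kinetic_energy m w) exprVn sqr_sqrtr ?divr_ge0 ?ltW//.
    by rewrite invf_div divfK// gt_eqF.
  by move=> i _; rewrite /z !coord_mk; ring.
- apply: state_ext => i; rewrite /z !coord_mk; split=> //; rewrite mulVKf// gt_eqF//.
Qed.

(* Disks near the grid points [i / N] at half height, moving almost vertically
   with vertical velocity about [h]. *)
Lemma cube_separated : exists (h e : R), [/\ 0 < e, e < N%:R^-1 &
  forall w, (forall i, [/\ i%:R / N%:R <= posx w i <= i%:R / N%:R + e,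
      2^-1 <= posy w i <= 2^-1 + e, 0 <= velx w i <= e & h <= vely w i <= h + e]) ->
    [/\ in_channel d w, moving w, reach_separated d lam w &
        0 < kinetic_energy m w <= E]].
Proof.
have d_half := diameter_lt_half.
(* With [u <= e <= h] and [v <= h + e <= 2 * h], each disk has squared speed at most [5 * h ^+ 2];
   [h] is chosen so that this bound adds up to exactly [E]. *)
pose h := Num.sqrt (2 * E / (5 * m * N%:R)).
have h0 : 0 < h by rewrite sqrtr_gt0 divr_gt0 ?mulr_gt0.
have h2 : m / 2 * (N%:R * (5 * h ^+ 2)) = E.
  rewrite sqr_sqrtr ?divr_ge0 ?mulr_ge0 ?ltW//; field.
  by rewrite !gt_eqF.
pose A := 1 - d + tail d lam.
have A0 : 0 < A by rewrite addr_gt0 ?tail_gt0 ?subr_gt0//; move: d_half; lra.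
(* Gaps are at least [1 / N - e] and each reach is at most [e * (A / h)], so separation follows from
   [e * c < 1 / N - d]. *)
pose c := 1 + 2 * (A / h).
have c1 : 1 <= c by rewrite lerDl mulr_ge0 ?divr_ge0 ?ltW.
have g0 : 0 < N%:R^-1 - d by rewrite subr_gt0.
pose g := (N%:R^-1 - d) / (2 * c).
have gc : g * c < N%:R^-1 - d.
  have -> : g * c = (N%:R^-1 - d) / 2 by rewrite /g; field; rewrite gt_eqF//; move: c1; lra.
  by move: g0; lra.
have gg0 : 0 < g by rewrite divr_gt0// mulr_gt0//; move: c1; lra.
(* The three bounds on [e] serve the energy, the room between the walls, and separation. *)
pose e := Num.min h (Num.min 4^-1 g).
have e0 : 0 < e by rewrite !lt_min h0 gg0 invr_gt0/= ltr0n.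
have eh : e <= h by rewrite ge_min lexx.
have e4 : e <= 4^-1 by rewrite !ge_min lexx orbT.
have eg : e <= g by rewrite !ge_min lexx !orbT.
have ec : e * c < N%:R^-1 - d.
  by apply: le_lt_trans gc; rewrite ler_wpM2r//; move: c1; lra.
exists h, e; split => //.
  apply: le_lt_trans (_ : e * c < _); first by rewrite ler_peMr// ltW.
  by apply: lt_trans ec _; rewrite gtrBl.
move=> w cube.
have yw : in_channel d w.
  move=> i; have [_ /andP[y1 y2] _ _] := cube i.
  by apply/andP; split; move: y1 y2 e4 d_half d_gt0; lra.
have vpos i : 0 < vely w i.
  by have [_ _ _ /andP[v1 _]] := cube i; exact: lt_le_trans h0 v1.
have vw : moving w by move=> i; rewrite gt_eqF.
have rw i : disk_reach d lam w i <= e * (A / h).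
  have := reach_rate lam (velx w i) (vw i) (yw i).
  rewrite -/(disk_reach d lam w i) -/A => hr.
  have [_ _ /andP[u0 ue] /andP[v1 _]] := cube i.
  rewrite mulrA ler_pdivlMr//.
  apply: (@le_trans _ _ (disk_reach d lam w i * `|vely w i|)).
    rewrite ler_wpM2l ?(gtr0_norm (vpos i))//.
    apply: disk_reach_ge0 => //; by move: d_half; lra.
  by apply: (le_trans hr); rewrite ler_wpM2r ?(ltW A0)// ger0_norm.
split=> //.
  move=> i j ij; have [/andP[x1 x2] _ _ _] := cube i; have [/andP[x3 x4] _ _ _] := cube j.
  have := @circle_dist_grid i j (posx w i - i%:R / N%:R) (posx w j - j%:R / N%:R) e ij.
  rewrite !subrKC !subr_ge0 !lerBlDl x1 x2 x3 x4 => /(_ isT isT).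
  by have := rw i; have := rw j; move: ec; rewrite /c; lra.
have sq i : h ^+ 2 <= velx w i ^+ 2 + vely w i ^+ 2 <= 5 * h ^+ 2.
  have [_ _ /andP[u0 ue] /andP[v1 v2]] := cube i.
  have u2 : velx w i ^+ 2 <= h ^+ 2 by rewrite ler_sqr ?nnegrE ?(ltW h0)// (le_trans ue).
  have v2h : vely w i ^+ 2 <= (2 * h) ^+ 2.
    by rewrite ler_sqr ?nnegrE ?mulr_ge0 ?(ltW (vpos i)) ?(ltW h0)//; move: v2 eh; lra.
  have v1h : h ^+ 2 <= vely w i ^+ 2 by rewrite ler_sqr ?nnegrE ?(ltW (vpos i)) ?(ltW h0).
  by have := sqr_ge0 (velx w i); move: u2 v2h v1h; lra.
have m20 : 0 < m / 2 by rewrite divr_gt0.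
apply/andP; split.
  apply: (@lt_le_trans _ _ (m / 2 * \sum_(i < N) h ^+ 2)).
    by rewrite sumr_const card_ord -[_ *+ N]mulr_natl mulr_gt0// mulr_gt0// exprn_gt0.
  by rewrite ler_pM2l//; apply: ler_sum => i _; case/andP: (sq i).
rewrite -h2 ler_pM2l//; apply: (@le_trans _ _ (\sum_(i < N) 5 * h ^+ 2)).
  by apply: ler_sum => i _; case/andP: (sq i).
by rewrite sumr_const card_ord -[_ *+ N]mulr_natl.
Qed.

Lemma phase_measure_non_colliding :
  (0 < phase_measure (non_colliding d lam m E : set (state R N)))%E.
Proof.
have [h [e [e0 eN cube]]] := cube_separated.
pose base : state R N := mk_state (fun i => i%:R / N%:R) (fun=> 2^-1) (fun=> 0) (fun=> h).
apply: (@lt_le_trans _ _ (e ^+ (N * 4))%:E); first by rewrite lte_fin exprn_gt0.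
apply: (@lebesgue_tuple_cube R _ (fun k => mxvec base ord0 k)); first exact: ltW.
move=> t tcube /=; set w : state R N := \matrix_(i, k) _.
have wE i k : base i k <= w i k <= base i k + e.
  by have := tcube (mxvec_index i k); rewrite mxvecE [w i k]mxE.
have cw i : [/\ i%:R / N%:R <= posx w i <= i%:R / N%:R + e,
    2^-1 <= posy w i <= 2^-1 + e, 0 <= velx w i <= e & h <= vely w i <= h + e].
  have p0 : posx base i <= posx w i <= posx base i + e := wE i (inord 0).
  have p1 : posy base i <= posy w i <= posy base i + e := wE i (inord 1).
  have p2 : velx base i <= velx w i <= velx base i + e := wE i (inord 2).
  have p3 : vely base i <= vely w i <= vely base i + e := wE i (inord 3).
  by move: p0 p1 p2 p3; rewrite /base !coord_mk add0r.
have [yw vw sw Kw] := cube w cw.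
split; last exact: non_colliding_cone.
move=> i; have [/andP[x0 x1] _ _ _] := cw i; apply/andP; split.
  by apply: le_trans x0; rewrite divr_ge0// ltW.
(* Because [e < 1 / N], even the last disk keeps [x < 1], inside the fundamental domain used by
   [phase_measure]. *)
apply: le_lt_trans x1 _; apply: (@lt_le_trans _ _ (i%:R / N%:R + N%:R^-1)).
  by rewrite ltrD2l.
rewrite -[X in _ + X]mul1r -mulrDl ler_pdivrMr// mul1r natr1 ler_nat; exact: ltn_ord.
Qed.

End PositiveMeasure.

(** * Gluing one-disk trajectories *)

Section Rows.
Variables (R : realType) (n : nat) (d lam : R).
Hypotheses (lam_gt0 : 0 < lam) (d_lt1 : d < 1).
Implicit Types (z w : state R n) (i : 'I_n).

Lemma coord_row z i (o : 'I_1) :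
  [/\ posx (row i z : state R 1) o = posx z i, posy (row i z : state R 1) o = posy z i,
      velx (row i z : state R 1) o = velx z i & vely (row i z : state R 1) o = vely z i].
Proof. by split; rewrite /posx /posy /velx /vely mxE. Qed.

Lemma row_free_flight (s : R) z i :
  row i (free_flight s z) = free_flight s (row i z : state R 1).
Proof.
apply: state_ext => o; have [-> -> -> ->] := coord_row (free_flight s z) i o.
by rewrite /free_flight !coord_mk; have [-> -> -> ->] := coord_row z i o.
Qed.

Lemma disk_reach_row z i : disk_reach d lam (row i z : state R 1) ord0 = disk_reach d lam z i.
Proof. by rewrite /disk_reach; have [_ -> -> ->] := coord_row z i ord0. Qed.

Lemma advances_row z w i :
  advances d lam (row i z : state R 1) (row i w : state R 1) ord0 ->
  advances d lam z w i.
Proof.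
rewrite /advances !disk_reach_row.
have [-> _ -> ->] := coord_row z i ord0.
by have [-> _ -> ->] := coord_row w i ord0.
Qed.

(** A separated state has no disk in contact with another, so the impacts of the system are exactly
    those of its disks taken alone. *)
Lemma impact_of_rows z w : in_channel d z -> moving z -> reach_separated d lam z ->
  (forall i, impact d lam (row i z : state R 1) (row i w)) -> impact d lam z w.
Proof.
move=> yz vz sz rows i; have [ex ey] := rows i ord0.
have [zx zy zu zv] := coord_row z i ord0.
have [wx wy wu wv] := coord_row w i ord0.
move: ex ey; rewrite zx zy wx wy => ex ey.
have nohit j p : ~ disk_hit d z i j p.
  by case=> /(separated_not_touching lam_gt0 d_lt1 yz vz sz).
have hitE : wall_hit d (row i z : state R 1) ord0 <-> wall_hit d z i.
  by rewrite /wall_hit zv zy.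
case.
- rewrite zu zv wu wv => hit _ eu ev; split=> //.
  by apply: NoImpact => // /hitE.
- rewrite zu zv wu wv => hit _ law; split=> //.
  by apply: WallImpact => //; apply/hitE.
- by move=> j p _ /no_disk_hit1.
Qed.

Lemma moving_before_impact1 (z w : state R 1) : impact d lam z w ->
  vely w ord0 != 0 -> vely z ord0 != 0.
Proof.
move=> /(_ ord0)[_ _ []]; first by move=> _ _ _ ->.
  by move=> _ _ /wall_vely_neq0[].
by move=> j p _ /no_disk_hit1.
Qed.

Lemma disk_reach_impact1 (z w : state R 1) : impact d lam z w ->
  disk_reach d lam w ord0 = disk_reach d lam z ord0.
Proof.
move=> /(_ ord0)[_ ey []]; first by move=> _ _ eu ev; rewrite /disk_reach ey eu ev.
  by move=> hit _; apply: disk_reach_identified.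
by move=> j p _ /no_disk_hit1.
Qed.

Lemma trajectory_exists z0 : in_channel d z0 -> moving z0 ->
  reach_separated d lam z0 -> exists z : R -> state R n, trajectory d lam +oo z0 z.
Proof.
move=> y0 v0 s0.
have ex i : exists w : R -> state R 1, trajectory d lam +oo (row i z0 : state R 1) w.
  apply: one_disk_trajectory => //.
    by apply: in_channel1; have [_ -> _ _] := coord_row z0 i ord0.
  by have [_ _ _ ->] := coord_row z0 i ord0.
have {ex}[w traj] := choice ex.
pose z (t : R) : state R n := \matrix_(i, k) w i t ord0 k.
have rowz i t : row i (z t) = w i t.
  by apply/rowP => k; rewrite !mxE.
have adv0 i : advances d lam (row i z0 : state R 1) (w i 0) ord0.
  have [imp _ _ _] := traj i; apply: advances_impact imp => //.
  - by move=> o; have [_ -> _ _] := coord_row z0 i o.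
  - by move=> o; have [_ _ _ ->] := coord_row z0 i o.
  - exact: separated1.
have adv t : 0 <= t -> forall i, advances d lam z0 (z t) i.
  move=> t0 i; apply: advances_row; rewrite rowz; apply: advances_trans (adv0 i) _.
  apply: trajectory_advances (traj i) _ _ _ _ _ _ => //; first by rewrite ltry.
    by move=> o; rewrite ord1; case: (adv0 i).
  exact: separated1.
have yz t : 0 <= t -> in_channel d (z t).
  move=> t0 i; have [_ <- _ _] := coord_row (z t) i ord0; rewrite rowz.
  by have [_ adm _ _] := traj i; case: (adm t t0) => //; rewrite ltry.
have vz t : 0 <= t -> moving (z t) by move=> t0 i; case: (adv t t0 i).
have sz t : 0 <= t -> reach_separated d lam (z t).
  by move=> t0; apply: advances_separated (adv t t0) => //; [exact: yz | exact: vz].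
exists z; split.
- by apply: impact_of_rows => // i; rewrite rowz; case: (traj i).
- move=> t t0 _; apply: (separated_admissible lam_gt0 d_lt1).
  + exact: yz.
  + exact: vz.
  + exact: sz.
- move=> t t0 tT.
  have h i : \forall s \near t^'+, w i s = free_flight (s - t) (w i t).
    by have [_ _ right _] := traj i; apply: right.
  apply: filterS (filter_forall _ h) => s hs.
  by apply/row_matrixP => i; rewrite row_free_flight !rowz hs.
- move=> t t0 tT.
  have h i : exists w_ : state R 1, impact d lam w_ (w i t) /\
      \forall s \near t^'-, w i s = free_flight (s - t) w_.
    by have [_ _ _ left] := traj i; have [w_ ? ?] := left t t0 tT; exists w_.
  have {h}[w_ hw] := choice h.
  (* The incoming state is glued from those of the single disks. An impact changes neither positions
     nor reaches, so [z_] inherits separation from [z t]. *)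
  pose z_ : state R n := \matrix_(i, k) w_ i ord0 k.
  have rowz_ i : row i z_ = w_ i by apply/rowP => k; rewrite !mxE.
  have imp i : impact d lam (row i z_ : state R 1) (row i (z t)).
    by rewrite rowz rowz_; case: (hw i).
  have ex i : posx (z t) i = posx z_ i.
    by have [+ _ _] := imp i ord0; have [-> _ _ _] := coord_row (z t) i ord0;
      have [-> _ _ _] := coord_row z_ i ord0.
  have ey i : posy (z t) i = posy z_ i.
    by have [_ + _] := imp i ord0; have [_ -> _ _] := coord_row (z t) i ord0;
      have [_ -> _ _] := coord_row z_ i ord0.
  have er i : disk_reach d lam (z t) i = disk_reach d lam z_ i.
    by have := disk_reach_impact1 (imp i); rewrite !disk_reach_row.
  exists z_.
    apply: impact_of_rows => //.
    + by move=> i; rewrite -ey; apply: yz; exact: ltW.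
    + move=> i; have [_ _ _ <-] := coord_row z_ i ord0.
      apply: moving_before_impact1 (imp i) _.
      by have [_ _ _ ->] := coord_row (z t) i ord0; apply: vz; exact: ltW.
    + by move=> i j ij; rewrite -!ex -!er; apply: sz => //; exact: ltW.
  apply: filterS (filter_forall _ (fun i => proj2 (hw i))) => s hs.
  by apply/row_matrixP => i; rewrite row_free_flight rowz rowz_ hs.
Qed.

End Rows.

(** * Invariance, convergence and decay *)

Section Dynamics.
Variables (R : realType) (n : nat) (d lam m E : R).
Hypotheses (lam_gt0 : 0 < lam) (d_lt1 : d < 1).
Implicit Types z : R -> state R n.

(** [z 0] may differ from [z0]: velocities incoming at time 0 are already replaced by outgoing
    ones. *)
Lemma trajectory_start (T : \bar R) (z0 : state R n) z : trajectory d lam T z0 z ->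
  in_channel d z0 -> moving z0 -> reach_separated d lam z0 ->
  (forall i, advances d lam z0 (z 0) i) /\ reach_separated d lam (z 0).
Proof.
move=> [imp _ _ _] y0 v0 s0.
have adv i := advances_impact lam_gt0 d_lt1 i y0 v0 s0 imp.
split=> //; apply: (advances_separated _ _ s0 adv).
  by move=> i; have [_ -> _] := imp i.
by move=> i; case: (adv i).
Qed.

Lemma non_colliding_invariant (z0 : state R n) (T : \bar R) z (t : R) :
  non_colliding d lam m E z0 -> trajectory d lam T z0 z -> 0 <= t ->
  (t%:E < T)%E ->
  non_colliding d lam m E (z t) /\ forall i j, ~ touching d (z t) i j.
Proof.
move=> /(non_collidingE _ _ lam_gt0 d_lt1)[[[y0 _] K0] v0 s0] traj t0 tT.
have [adv0 s0'] := trajectory_start traj y0 v0 s0.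
have v0' : moving (z 0) by move=> i; case: (adv0 i).
have adv i : advances d lam z0 (z t) i.
  apply: advances_trans (adv0 i) _.
  exact: (trajectory_advances lam_gt0 d_lt1 traj (lexx 0) t0 tT).
have adm : admissible d (z t) by case: traj => _ adm _ _; apply: adm.
have yt : in_channel d (z t) by case: adm.
have vt : moving (z t) by move=> i; case: (adv i).
have st : reach_separated d lam (z t) by apply: advances_separated adv.
split; last by move=> i j; apply: (separated_not_touching lam_gt0 d_lt1).
apply/(non_collidingE _ _ lam_gt0 d_lt1); split=> //; split=> //=.
rewrite -K0; congr (_ * _); apply: eq_bigr => i _.
by case: (adv i).
Qed.

Lemma posx_cvg (z0 : state R n) z i :
  non_colliding d lam m E z0 -> trajectory d lam +oo z0 z ->
  exists a : R, posx (z t) i @[t --> +oo] --> a.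
Proof.
move=> /(non_collidingE _ _ lam_gt0 d_lt1)[[[y0 _] _] v0 s0] traj.
have [adv0 s0'] := trajectory_start traj y0 v0 s0.
have v0' : moving (z 0) by move=> j; case: (adv0 j).
have y0' : in_channel d (z 0).
  by have [_ adm _ _] := traj; case: (adm 0 (lexx 0)) => //; rewrite ltry.
(* The limit is the point where the whole initial reach has been used up; the error at time [t] is
   the reach still left. *)
exists (posx (z 0) i + Num.sg (velx (z 0) i) * disk_reach d lam (z 0) i).
apply/cvgrPdist_le => e e0.
have r0 := disk_reach_ge0 lam_gt0 d_lt1 y0' (v0' i).
have [T T0 small] := exp_decay_le r0 (decay_rate_gt0 lam_gt0 d_lt1 (v0' i)) e0.
exists T; split; first exact: num_real.
move=> t /ltW Tt; have t0 : 0 <= t by exact: le_trans Tt.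
have tT : (t%:E < +oo)%E by rewrite ltry.
have [vt _ _ _ ->] := trajectory_advances lam_gt0 d_lt1 traj (lexx 0) t0 tT v0' s0' i.
have yt : in_channel d (z t) by have [_ adm _ _] := traj; case: (adm t t0 tT).
have rt := disk_reach_ge0 lam_gt0 d_lt1 yt vt.
set s := Num.sg _; set r := disk_reach _ _ _ _; set r' := disk_reach _ _ _ _.
have -> : posx (z 0) i + s * r - (posx (z 0) i + s * (r - r')) = s * r' by ring.
rewrite normrM (ger0_norm rt); apply: (@le_trans _ _ r').
  by rewrite ler_piMl// normr_sg lern1 leq_b1.
apply: le_trans (small t Tt).
exact: (disk_reach_decay lam_gt0 d_lt1 i traj t0 tT v0' s0').
Qed.

Lemma velx_exp_decay (z0 : state R n) z :
  non_colliding d lam m E z0 -> trajectory d lam +oo z0 z ->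
  exists C c : R, [/\ 0 < C, 0 < c &
    forall (t : R) i, 0 <= t -> `|velx (z t) i| <= C * expR (- c * t)].
Proof.
move=> /(non_collidingE _ _ lam_gt0 d_lt1)[[[y0 _] _] v0 s0] traj.
have [adv0 s0'] := trajectory_start traj y0 v0 s0.
have v0' : moving (z 0) by move=> j; case: (adv0 j).
have y0' : in_channel d (z 0).
  by have [_ adm _ _] := traj; case: (adm 0 (lexx 0)) => //; rewrite ltry.
pose C i := disk_reach d lam (z 0) i *
  Num.sqrt (velx (z 0) i ^+ 2 + vely (z 0) i ^+ 2) / tail d lam.
(* Sums replace maxima over the disks: [1 + \sum_j b j] exceeds every inverse rate, so its inverse
   is a common rate. The added 1 keeps both constants positive. *)
pose b i := (decay_rate d lam (z 0) i)^-1.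
have C0 i : 0 <= C i.
  rewrite divr_ge0 ?(ltW (tail_gt0 lam_gt0 d_lt1))// mulr_ge0 ?sqrtr_ge0//.
  exact: disk_reach_ge0.
have b0 i : 0 < b i by rewrite invr_gt0 decay_rate_gt0.
have le_sum (f : 'I_n -> R) i : (forall j, 0 <= f j) -> f i <= 1 + \sum_j f j.
  by move=> f0; rewrite (bigD1 i)//= addrCA lerDl addr_ge0// sumr_ge0.
have B0 : 0 < 1 + \sum_j b j.
  by rewrite ltr_pwDl// sumr_ge0// => i _; exact: ltW.
exists (1 + \sum_j C j), (1 + \sum_j b j)^-1; split.
- by rewrite ltr_pwDl// sumr_ge0.
- by rewrite invr_gt0.
move=> t i t0; have tT : (t%:E < +oo)%E by rewrite ltry.
apply: le_trans (velx_decay lam_gt0 d_lt1 i traj t0 tT v0' s0') _.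
apply: ler_pM; rewrite ?expR_ge0 ?(C0 i)//; first exact: le_sum.
rewrite ler_expR !mulNr lerN2 ler_wpM2r// -[leRHS]invrK lef_pV2 ?posrE//.
  by apply: (le_sum b) => j; exact: ltW.
exact: b0.
Qed.

End Dynamics.

Theorem mainTheorem1 (R : realType) (N : nat) (d lam m E : R)
    (hN : (2 <= N)%N) (hlam : 0 < lam) (hd0 : 0 < d) (hdN : d < N%:R^-1)
    (hm : 0 < m) (hE : 0 < E) :
  let U : set (state R N) := non_colliding d lam m E in
  [/\ phase_open d lam m E U,
      (0 < phase_measure U)%E,
      (forall z0, U z0 -> exists z, trajectory d lam +oo z0 z),
      (forall z0 T z, U z0 -> trajectory d lam T z0 z ->
        forall t : R, 0 <= t -> (t%:E < T)%E ->
          U (z t) /\ forall i j, ~ touching d (z t) i j) &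
      (forall z0 z, U z0 -> trajectory d lam +oo z0 z ->
        (forall i, exists a : R, posx (z t) i @[t --> +oo] --> a) /\
        exists C c : R, [/\ 0 < C, 0 < c &
          forall (t : R) i, 0 <= t -> `|velx (z t) i| <= C * expR (- c * t)])].
Proof.
have d1 : d < 1 := diameter_lt1 hN hdN.
move=> U; split.
- exact: phase_open_non_colliding.
- exact: phase_measure_non_colliding.
- by move=> z0 /(non_collidingE _ _ hlam d1)[[[y0 _] _] v0 s0]; apply: trajectory_exists.
- by move=> z0 T z Uz0 traj t t0 tT; apply: non_colliding_invariant traj t0 tT.
- move=> z0 z Uz0 traj; split; last exact: (velx_exp_decay hlam d1 Uz0 traj).
  by move=> i; exact: (posx_cvg hlam d1 i Uz0 traj).
Qed.
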